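(* Let $X\subset\{1,3\}^{\mathbb Z}$ be the set of bi-infinite smooth sequences, and for $\tau\in\{0,1\}^{\mathbb N}$ let $X_\tau\subset X$ be the set of those whose sequence of types is $\tau$. Then each $X_\tau$ is a (nonempty) subshift, $X$ is the disjoint union $$X=\bigsqcup_{\tau\in\{0,1\}^{\mathbb N}}X_\tau,$$ and for every $\tau\in\{0,1\}^{\mathbb N}$ the subshift $(X_\tau,S)$ is uniquely ergodic, i.e. there is exactly one $S$-invariant Borel probability measure on $X_\tau$.
   Context: Conventions: $\mathbb N=\{0,1,2,\dots\}$; $S$ is the shift, $(Sx)_n=x_{n+1}$; a subshift is a nonempty closed subset $Z$ of $\Sigma^{\mathbb Z}$ ($\Sigma$ finite, product topology) with $S(Z)=Z$. Smooth sequences. A mono-symbol block of $x\in\{1,3\}^{\mathbb Z}$ is a maximal run of equal consecutive symbols. If all mono-symbol blocks of $x$ are finite, the derivative $\Delta x$ is the bi-infinite sequence of lengths of the consecutive mono-symbol blocks of $x$, indexed so that $(\Delta x)_0$ is the length of the block containing position $0$. $x$ is differentiable if $\Delta x$ is well-defined and belongs to $\{1,3\}^{\mathbb Z}$; it is smooth if it is infinitely differentiable ($\Delta^k x$ is well-defined and in $\{1,3\}^{\mathbb Z}$ for all $k\ge0$). Recoding. Let $\mathcal A=\{\mathtt A,\mathtt B,\mathtt C,\mathtt D\}$ encode the blocks $\mathtt A=1$, $\mathtt B=3$, $\mathtt C=111$, $\mathtt D=333$. For $x\in X$, $\mathrm{rec}(x)\in\mathcal A^{\mathbb Z}$ is the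 sequence of codes of the consecutive mono-symbol blocks of $x$, with $\mathrm{rec}(x)_0$ the code of the block containing $x_0$. Elementary blocks. Each letter of $y=\mathrm{rec}(x)$ corresponds to one letter of $\Delta x$. The factor of $y$ corresponding to a mono-symbol block of $\Delta x$ is called an elementary block of $y$: the block $1$ gives $\mathtt A$ or $\mathtt B$; $3$ gives $\mathtt C$ or $\mathtt D$; $111$ gives $\mathtt{ABA}$ or $\mathtt{BAB}$; $333$ gives $\mathtt{CDC}$ or $\mathtt{DCD}$. Types. $x\in X$ has type $0$ if $\mathrm{rec}(x)$ contains an elementary block in $\{\mathtt{ABA},\mathtt{DCD}\}$, and type $1$ if it contains an elementary block in $\{\mathtt{BAB},\mathtt{CDC}\}$; every $x\in X$ has exactly one type. The sequence of types of $x$ is $\mathrm{Types}(x)=(\mathrm{type}(\Delta^n x))_{n\in\mathbb N}$, and $X_\tau=\{x\in X:\mathrm{Types}(x)=\tau\}$. *)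

(* Defs.v *)
From HB Require Import structures.
From mathcomp Require Import all_boot all_order all_algebra.
From mathcomp Require Import all_classical all_reals all_analysis.

Set Implicit Arguments.
Unset Strict Implicit.
Unset Printing Implicit Defensive.

Import Order.TTheory GRing.Theory Num.Theory.

Local Open Scope classical_set_scope.
Local Open Scope ring_scope.

Definition full_shift (Sigma : finType) : topologicalType :=
  prod_topology (fun _ : int => discrete_topology Sigma).

Definition shift (Sigma : finType) (x : full_shift Sigma) : full_shift Sigma :=
  fun n => x (n + 1).

Record is_subshift (Sigma : finType) (Z : set (full_shift Sigma)) : Prop :=
  IsSubshift {
    subshift_neq0 : Z !=set0 ;
    subshift_closed : closed Z ;
    subshift_image : @shift Sigma @` Z = Z }.

Record subshift (Sigma : finType) := Subshift {
  subshift_carrier :> set (full_shift Sigma) ;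
  subshiftP : is_subshift subshift_carrier }.

(* The phase space of [Z] carries the subspace topology. It is pointed, as
   [measurableType] requires, because subshifts are nonempty. *)
Definition subshift_space (Sigma : finType) (Z : subshift Sigma) : Type :=
  set_type (Z : set (full_shift Sigma)).

Section SubshiftSpace.
Variables (Sigma : finType) (Z : subshift Sigma).

Definition subshift_point : subshift_space Z :=
  let: exist x Zx := cid (subshift_neq0 (subshiftP Z)) in SigSub (mem_set Zx).

HB.instance Definition _ := Topological.on (subshift_space Z).
HB.instance Definition _ := isPointed.Build (subshift_space Z) subshift_point.

Lemma shift_subproof (x : subshift_space Z) : shift (set_val x) \in (Z : set _).
Proof.
have [_ _ SZ] := subshiftP Z; apply: mem_set.
suff: (@shift Sigma @` Z) (shift (set_val x)) by rewrite SZ.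
by exists (set_val x) => //; exact: set_valP.
Qed.

Definition shift_on (x : subshift_space Z) : subshift_space Z :=
  SigSub (shift_subproof x).

End SubshiftSpace.

Definition borel (T : ptopologicalType) := g_sigma_algebraType (@open T).

Definition invariant_measure (R : realType) (T : ptopologicalType)
    (f : T -> T) (mu : probability (borel T) R) : Prop :=
  forall A : set (borel T), measurable A -> mu (f @^-1` A) = mu A.

(* The function underlying a [probability] is unconstrained on nonmeasurable
   sets, so measures are compared on Borel sets only. *)
Definition uniquely_ergodic (R : realType) (T : ptopologicalType)
    (f : T -> T) : Prop :=
  exists2 mu : probability (borel T) R, invariant_measure f mu &
    forall nu : probability (borel T) R, invariant_measure f nu ->
      forall A : set (borel T), measurable A -> nu A = mu A.

(* [b k] is the first position of the [k]-th mono-symbol block of [x], block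
   number 0 being the one that contains position 0. Such a [b] exists exactly
   when all mono-symbol blocks of [x] are finite, and it is then unique. *)
Definition is_block_starts (T : Type) (x : int -> T) (b : int -> int) : Prop :=
  b 0 <= 0 < b 1 /\
  forall k, [/\ b k < b (k + 1),
    forall i, b k <= i < b (k + 1) -> x i = x (b k) &
    x (b (k + 1)) <> x (b k)].

Definition finite_blocks (T : Type) (x : int -> T) : Prop :=
  exists b, is_block_starts x b.

Definition block_start (T : Type) (x : int -> T) : int -> int :=
  xget (fun=> 0) [set b | is_block_starts x b].

Definition block_length (T : Type) (x : int -> T) (k : int) : nat :=
  `|block_start x (k + 1) - block_start x k|%N.

Inductive symbol := One | Three.

Definition symbol_to_bool (s : symbol) : bool :=
  if s is Three then true else false.
Definition bool_to_symbol (b : bool) : symbol := if b then Three else One.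
Lemma symbol_to_boolK : cancel symbol_to_bool bool_to_symbol.
Proof. by case. Qed.
HB.instance Definition _ := Finite.copy symbol (can_type symbol_to_boolK).

Definition differentiable13 (x : int -> symbol) : Prop :=
  finite_blocks x /\ forall k, block_length x k = 1%N \/ block_length x k = 3%N.

(* The derivative is a total function, meaningful only if [differentiable13 x]. *)
Definition derivative13 (x : int -> symbol) : int -> symbol :=
  fun k => if block_length x k == 3%N then Three else One.

Definition smooth_sequences : set (full_shift symbol) :=
  [set x | forall n, differentiable13 (iter n derivative13 x)].

(* The codes of the blocks 1, 3, 111 and 333 respectively. *)
Inductive letter := LA | LB | LC | LD.

Definition code (s len : symbol) : letter :=
  match s, len with
  | One, One => LA
  | Three, One => LB
  | One, Three => LC
  | Three, Three => LD
  end.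

Definition recoding (x : int -> symbol) : int -> letter :=
  fun k => code (x (block_start x k)) (derivative13 x k).

(* The factor of [recoding x] at the positions of the [j]-th mono-symbol block
   of the derivative of [x]. *)
Definition elementary_block (x : int -> symbol) (j : int) : seq letter :=
  [seq recoding x (block_start (derivative13 x) j + i%:Z)
     | i <- iota 0 (block_length (derivative13 x) j)].

(* [false] stands for type 0 and [true] for type 1. *)
Definition has_type (x : int -> symbol) (t : bool) : Prop :=
  exists j, let w := elementary_block x j in
    if t then w = [:: LB; LA; LB] \/ w = [:: LC; LD; LC]
    else w = [:: LA; LB; LA] \/ w = [:: LD; LC; LD].

Definition smooth_of_types (tau : nat -> bool) : set (full_shift symbol) :=
  [set x | smooth_sequences x /\
           forall n, has_type (iter n derivative13 x) (tau n)].

(* Main.v *)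
(* Identify types 0 and 1 with the signs +1 and -1. In a smooth x the blocks of
   ones and of threes alternate and have odd lengths; therefore the sum of the
   signs (3 -> +1, 1 -> -1) of the letters of Δ x over a long interval is, up to
   O(1), the sign of the type of Δ x times the number of blocks of Δ^2 x. As a
   letter of Δ x stands for 2 +- 1 letters of x, the number N_n of letters of
   Δ^n x over the interval satisfies N_n = 2 N_{n+1} +- N_{n+3} + O(1), the sign
   being that of the type of Δ^{n+1} x. Moreover N_{n+1} + N_{n+2} <= N_n + O(1)
   keeps the ratios N_n / N_{n+1} above 13/10, where (r, s) |-> 2 +- 1 / (r s)
   contracts, so the ratios converge, uniformly, to constants that depend on the
   types only. A level-n block of x is determined by the types and by one of four
   letters, whose numbers of occurrences are, up to O(1), linear in N_{n+1},
   N_{n+2} and N_{n+3}. As N_n / N_0 -> 0, the boundaries of level-n blocks do not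
   matter, and every local set has a uniform frequency. The frequencies form a
   premeasure on the clopen algebra, and its Caratheodory extension is the unique
   invariant measure. *)
Require Import Defs.
From HB Require Import structures.
From mathcomp Require Import all_boot all_order all_algebra.
From mathcomp Require Import all_classical all_reals all_analysis.
From mathcomp Require Import measurable_realfun.
From mathcomp Require Import zify ring lra.

Set Implicit Arguments.
Unset Strict Implicit.
Unset Printing Implicit Defensive.

Import Order.TTheory GRing.Theory Num.Theory.
Import numFieldNormedType.Exports.

Local Open Scope classical_set_scope.
Local Open Scope ring_scope.

(** * Cylinder sets *)

Section Cylinders.
Variable Sigma : finType.
Implicit Types (x y : full_shift Sigma) (m : nat).

Definition agree m x y := forall i : int, (`|i| <= m)%N -> x i = y i.

Definition local_set (B : set (full_shift Sigma)) :=
  exists m, forall x y, agree m x y -> B x -> B y.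

Lemma agree_sym m x y : agree m x y -> agree m y x.
Proof. by move=> xy i /xy ->. Qed.

Lemma agree_le m m' x y : (m <= m')%N -> agree m' x y -> agree m x y.
Proof. by move=> mm' xy i im; apply: xy; apply: leq_trans im mm'. Qed.

Lemma nbhs_coord x (i : int) : nbhs x [set y | x i = y i].
Proof.
have := @proj_continuous _ (fun _ : int => discrete_topology Sigma) i x.
move=> /(_ [set a | x i = a]) /=; apply.
suff -> : [set a | x i = a] = [set x i].
  exact: (@discrete_set1 (discrete_topology Sigma)).
by apply/seteqP; split=> a /= ->.
Qed.

Lemma nbhs_agree m x : nbhs x [set y | agree m x y].
Proof.
elim: m => [|m IH].
  apply: (filterS _ (nbhs_coord x 0)) => y /= xy i.
  by rewrite leqn0 absz_eq0 => /eqP ->.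
have xnbhs : nbhs x ([set y | agree m x y] `&`
    ([set y | x m.+1%:Z = y m.+1%:Z] `&` [set y | x (- m.+1%:Z) =
      y (- m.+1%:Z)])).
  by apply: filterI => //; apply: filterI; exact: nbhs_coord.
apply: (filterS _ xnbhs) => y /= [xy [xy1 xy2]] i.
move=> im1; have [/xy//|mi] := leqP `|i| m.
by have [->|->] : i = m.+1%:Z \/ i = - m.+1%:Z by lia.
Qed.

(** The product topology is the supremum of the topologies induced by the coordinates, and the
    filter generated by the cylinders around [x] converges for each of them. *)
Lemma nbhs_agreeP x (U : set (full_shift Sigma)) :
  nbhs x U <-> exists m, [set y | agree m x y] `<=` U.
Proof.
split; last by move=> [m mU]; exact: (filterS mU (nbhs_agree m x)).
pose F := filter_from [set: nat] (fun m => [set y | agree m x y]).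
have FF : Filter F.
  apply: filter_from_filter; first by exists 0%N.
  move=> i j _ _; exists (maxn i j) => // y xy; split;
  by apply: agree_le xy; lia.
suff : F --> x by move=> /[apply] -[m _ mU]; exists m.
apply/cvg_sup => i A /= [/= B [[C oC <-] Cx CA]].
exists `|i|%N => // y /= xy; apply: CA => /=.
by rewrite -xy.
Qed.

Lemma local_open B : local_set B -> open B.
Proof.
move=> [m mB]; rewrite openE => x Bx; apply/nbhs_agreeP; exists m => y /= xy.
exact: mB xy Bx.
Qed.

Lemma local_setC B : local_set B -> local_set (~` B).
Proof.
by move=> [m mB]; exists m => x y xy Bx By; apply: Bx; apply: mB By;
  apply: agree_sym.
Qed.

Lemma local_setU B C : local_set B -> local_set C -> local_set (B `|` C).
Proof.
move=> [m mB] [m' mC]; exists (maxn m m') => x y xy [Bx|Cx].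
- by left; apply: mB Bx; apply: agree_le xy; lia.
- by right; apply: mC Cx; apply: agree_le xy; lia.
Qed.

Lemma local_set0 : local_set set0.
Proof. by exists 0%N. Qed.

Lemma local_preimage_shift B : local_set B ->
  local_set (@Defs.shift Sigma @^-1` B).
Proof.
move=> [m mB]; exists m.+1 => x y xy; apply: mB => i im; apply: xy.
by lia.
Qed.

Lemma compact_full_shift : compact [set: full_shift Sigma].
Proof.
have := @tychonoff int (fun _ => discrete_topology Sigma) (fun _ => setT).
move=> /(_ _)/wrap[i|].
  by apply: finite_compact; exact: finite_finset.
by congr compact; apply/seteqP; split.
Qed.

(** Compactness in the form used twice below: to reduce countable to finite additivity, and to find
    a sequence with infinitely many prescribed types. *)
Lemma nested_closed_nonempty (B : nat -> set (full_shift Sigma)) :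
  (forall n, closed (B n)) -> (forall n, B n !=set0) ->
  (forall n, B n.+1 `<=` B n) -> \bigcap_n B n !=set0.
Proof.
move=> cB B0 BS.
have Bmono i j : (i <= j)%N -> B j `<=` B i.
  move=> /subnK <-; elim: (j - i)%N => // k IH.
  by rewrite addSn; apply: subset_trans IH; exact: BS.
pose F := filter_from [set: nat] B.
have FF : ProperFilter F.
  apply: filter_from_proper; last by move=> n _; exact: B0.
  apply: filter_from_filter; first by exists 0%N.
  move=> i j _ _; exists (maxn i j) => // y By; split;
  by apply: Bmono By; lia.
have [|p [_ pF]] := @compact_full_shift F FF.
  by apply: filterS (_ : F (B 0%N)) => //; exists 0%N.
exists p => n _; apply: cB => A pA.
by apply: pF => //; exists n.
Qed.

End Cylinders.

(** * Subshifts with uniform frequencies *)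

Section ClopenAlgebra.
Variables (Sigma : finType) (Z : subshift Sigma).

(** A separate name for the phase space, on which the measurable sets are the clopen ones; the Borel
    structure lives on [borel (subshift_space Z)]. *)
Definition clopen_space : Type := subshift_space Z.

Definition clopen_set (A : set clopen_space) :=
  exists2 B, local_set B & A = set_val @^-1` B.

Lemma clopen_set0 : clopen_set set0.
Proof. by exists set0; [exact: local_set0|rewrite preimage_set0]. Qed.

Lemma clopen_setU : setU_closed clopen_set.
Proof.
move=> _ _ [B lB ->] [C lC ->]; exists (B `|` C); first exact: local_setU.
by rewrite preimage_setU.
Qed.

Lemma clopen_setC : setC_closed clopen_set.
Proof.
move=> _ [B lB ->]; exists (~` B); first exact: local_setC.
by rewrite preimage_setC.
Qed.

HB.instance Definition _ := Pointed.copy clopen_space (subshift_space Z).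
HB.instance Definition _ := isAlgebraOfSets.Build default_measure_display
  clopen_space clopen_set0 clopen_setU clopen_setC.

Lemma clopen_preimage_shift A :
  clopen_set A -> clopen_set (@shift_on Sigma Z @^-1` A).
Proof.
move=> [B lB ->]; exists (@Defs.shift Sigma @^-1` B) => //.
exact: local_preimage_shift.
Qed.

Lemma clopen_open (A : set (subshift_space Z)) : clopen_set A -> open A.
Proof. by move=> [B lB ->]; exists B => //; exact: local_open. Qed.

Definition window m (x : full_shift Sigma) : seq Sigma :=
  [seq x (i%:Z - m%:Z) | i <- iota 0 m.*2.+1].

Lemma window_agree m x y : window m x = window m y <-> agree m x y.
Proof.
split=> [xy i im|xy].
  pose j := absz (i + m%:Z).
  have jm : (j < m.*2.+1)%N by rewrite /j; lia.
  have iE : i = (nth 0%N (iota 0 m.*2.+1) j)%:Z - m%:Z.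
    by rewrite nth_iota // add0n /j; lia.
  have /(congr1 (fun s => nth (x i) s j)) := xy.
  by rewrite !(nth_map 0%N) ?size_iota // -iE.
by apply/eq_in_map => j; rewrite mem_iota => jm; apply: xy; lia.
Qed.

(** An open set is the union of the cylinders that it contains, and there are only countably many
    pairs of a radius and a finite word. *)
Lemma open_sigma_clopen (U : set (subshift_space Z)) :
  open U -> <<s clopen_set >> U.
Proof.
move=> [V oV VU].
pose C (p : nat * seq Sigma) : set clopen_space :=
  if `[< [set x | window p.1 x = p.2] `<=` V >]
  then set_val @^-1` [set x | window p.1 x = p.2] else set0.
have -> : U = \bigcup_p C p.
  rewrite -VU; apply/seteqP; split=> [x Vx|x [p _]]; last first.
    by rewrite /C; case: asboolP => // + xp; apply.
  have /nbhs_agreeP[m mV] : nbhs (set_val x) V by exact: open_nbhs_nbhs.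
  exists (m, window m (set_val x)) => //; rewrite /C; case: asboolP => //.
  by move=> []; move=> y /= /esym /window_agree /mV.
suff : forall p, (@clopen_set).-sigma.-measurable (C p).
  exact: countable_bigcupT_measurable.
move=> p; apply: sub_sigma_algebra; rewrite /C; case: asboolP => _; last first.
  exact: clopen_set0.
eexists; last reflexivity.
exists p.1 => x y /window_agree /= <- //.
Qed.

Lemma borel_sigma_clopen (A : set (borel (subshift_space Z))) :
  measurable A <-> <<s clopen_set >> A.
Proof.
split.
  apply: smallest_sub; first exact: smallest_sigma_algebra.
  exact: open_sigma_clopen.
apply: smallest_sub; first exact: smallest_sigma_algebra.
by move=> B /clopen_open; exact: sub_sigma_algebra.
Qed.

Lemma shift_on_measurable :
  measurable_fun setT (@shift_on Sigma Z : borel _ -> borel _).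
Proof.
move=> _ A mA; rewrite setTI; move: A mA.
suff : <<s clopen_set >> `<=` [set A | <<s clopen_set >> (@shift_on Sigma Z
  @^-1` A)].
  by move=> sub A /borel_sigma_clopen /sub /borel_sigma_clopen.
apply: smallest_sub => [|A clA].
  have := @smallest_sigma_algebra clopen_space setT clopen_set => -[s0 sC sU].
  split=> /=.
  - by rewrite preimage_set0.
  - by move=> A mA; rewrite -[X in _ X]/(setT `\` (@shift_on Sigma Z @^-1` A));
    exact: sC.
  - by move=> F mF; rewrite preimage_bigcup; exact: sU.
by apply: sub_sigma_algebra; exact: clopen_preimage_shift.
Qed.

(** The remainders [U n] are clopen and decreasing. If none were empty, compactness would give a
    point of the union that lies in no [F i]. *)
Lemma clopen_trivIset_finite (F : nat -> set clopen_space) :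
  (forall i, clopen_set (F i)) -> trivIset setT F ->
  clopen_set (\bigcup_i F i) -> exists N, forall i, (N <= i)%N -> F i = set0.
Proof.
move=> clF tF clU.
pose U n : set clopen_space :=
  (\bigcup_i F i) `\` (\big[setU/set0]_(i < n) F i).
have clUn n : clopen_set (U n).
  rewrite /U setDE.
  have -> : (\bigcup_i F i) `&` ~` (\big[setU/set0]_(i < n) F i) =
    ~` (~` (\bigcup_i F i) `|` (\big[setU/set0]_(i < n) F i)).
    by rewrite setCU setCK.
  apply: clopen_setC; apply: clopen_setU; first exact: clopen_setC.
  by elim/big_ind : _ => //; [exact: clopen_set0|exact: clopen_setU].
have [/existsNP[N]|U0] := pselect (~ forall n, U n !=set0).
  move=> /nonemptyPn; rewrite /U setD_eq0 => UN.
  exists N => i Ni; apply/eqP/negPn/negP => /set0P[x Fx].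
  have : (\bigcup_i F i) x by exists i.
  move=> /UN; rewrite -bigcup_mkord => -[j /= jN Fjx].
  have ij : i = j by apply: (tF i j) => //; exists x.
  by move: jN; rewrite -ij ltnNge Ni.
exfalso; move/contrapT : U0 => U0.
have [_ cZ _] := subshiftP Z.
have [|||x xU] := @nested_closed_nonempty Sigma (fun n => set_val @` (U n)).
- move=> n; have [B [m mB] UB] := clUn n.
  rewrite UB.
  have -> : set_val @` (set_val @^-1` B : set clopen_space) = (Z : set _) `&` B.
    apply/seteqP; split=> [_ [x Bx <-]|x [Zx Bx]].
      by split => //; exact: set_valP.
    by exists (SigSub (mem_set Zx)).
  apply: closedI => //; rewrite -[B]setCK; apply: open_closedC.
  by apply: local_open; apply: local_setC; exists m.
- by move=> n; have [x Ux] := U0 n; exists (set_val x); exists x.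
- by move=> n; apply: image_subset; apply: setDS; rewrite big_ord_recr;
  exact: subsetUl.
- have [y] := xU 0%N I.
  move=> [[i _ Fiy] _] yx.
  have [z Uz zx] := xU i.+1 I.
  have yz : z = y by apply: val_inj; rewrite -[LHS]/(set_val z) zx -yx.
  move: Uz; rewrite yz => -[_]; rewrite -bigcup_mkord; apply.
  by exists i => //=.
Qed.

End ClopenAlgebra.

(** * The invariant measure defined by uniform frequencies, and its uniqueness *)

Section UniqueErgodicity.
Variables (R : realType) (Sigma : finType) (Z : subshift Sigma).
Local Notation T := (subshift_space Z).
Local Notation f := (@shift_on Sigma Z).
Implicit Types (A : set T) (x : T).

Definition visits A n x : R := \sum_(i < n) \1_A (iter i f x).

Definition uniform_frequency A (c : R) := forall e, 0 < e ->
  exists N, forall n x, (N <= n)%N -> `|visits A n x - c * n%:R| <= e * n%:R.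

Definition frequency A : R := xget 0 (uniform_frequency A).

Lemma uniform_frequency_cvg A c x : uniform_frequency A c ->
  visits A n x / n%:R @[n --> \oo] --> c.
Proof.
move=> cP; apply/cvgrPdist_le => e e0; have [N NP] := cP _ e0.
exists N.+1 => // n /= Nn; have n0 : 0 < n%:R :> R by rewrite ltr0n; lia.
rewrite distrC -(ler_pM2r n0) -[X in _ * X <= _](gtr0_norm n0) -normrM mulrBl.
by rewrite divfK ?gt_eqF //; apply: NP; exact: ltnW.
Qed.

Lemma frequency_ge0 A : 0 <= frequency A.
Proof.
rewrite /frequency; case: xgetP => // c _ /(uniform_frequency_cvg point) cP.
rewrite -(cvg_lim _ cP) //; apply: limr_ge; first by apply/cvg_ex; exists c.
apply: nearW => n; apply: mulr_ge0; last by rewrite invr_ge0.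
by apply: sumr_ge0 => i _; rewrite indicE.
Qed.

Hypothesis freqZ : forall A, @clopen_set _ Z A ->
  exists c, uniform_frequency A c.

Lemma frequencyP A : clopen_set A -> uniform_frequency A (frequency A).
Proof. by move=> /freqZ [c cP]; apply: xgetPex; exists c. Qed.

Lemma frequency_cvg A x : clopen_set A ->
  visits A n x / n%:R @[n --> \oo] --> frequency A.
Proof. by move=> /frequencyP; exact: uniform_frequency_cvg. Qed.

Lemma frequency0 : frequency set0 = 0.
Proof.
rewrite -(cvg_lim _ (frequency_cvg point _)) //; last exact: clopen_set0.
apply/cvg_lim => //; apply: cvg_near_cst; apply: nearW => n.
by rewrite /visits big1 ?mul0r // => i _; rewrite indic0.
Qed.

Lemma frequencyT : frequency setT = 1.
Proof.
rewrite -(cvg_lim _ (frequency_cvg point _)) //; last first.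
  by rewrite -setC0; apply: clopen_setC; exact: clopen_set0.
apply/cvg_lim => //; apply: cvg_near_cst.
exists 1%N => // n /= n0.
rewrite /visits (eq_bigr (fun=> 1)); last by move=> i _; rewrite indicT.
by rewrite sumr_const card_ord divff // pnatr_eq0 -lt0n.
Qed.

Lemma frequencyU A B : clopen_set A -> clopen_set B -> A `&` B = set0 ->
  frequency (A `|` B) = frequency A + frequency B.
Proof.
move=> clA clB AB0.
rewrite -(cvg_lim _ (frequency_cvg point (clopen_setU clA clB))) //.
apply/cvg_lim => //.
have /(_ _) := cvgD (frequency_cvg point clA) (frequency_cvg point clB).
apply: cvg_trans; apply: near_eq_cvg; apply: nearW => n /=.
rewrite fctE -mulrDl /visits -big_split /=; congr (_ / _);
  apply: eq_bigr => i _.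
rewrite !indicE in_setU; case: (boolP (_ \in A)) => iA;
  case: (boolP (_ \in B)) => iB //=.
  have : (A `&` B) (iter i f point) by split;
    [exact: set_mem iA|exact: set_mem iB].
  by rewrite AB0.
all: by rewrite ?addr0 ?add0r.
Qed.

(** The limit does not depend on the starting point, and the visits to the preimage from [point] are
    the visits to [A] from [f point]. *)
Lemma frequency_shift A : clopen_set A -> frequency (f @^-1` A) = frequency A.
Proof.
move=> clA.
rewrite -(cvg_lim _ (frequency_cvg point (clopen_preimage_shift clA))) //.
apply/cvg_lim => //.
have := frequency_cvg (f point) clA.
apply: cvg_trans; apply: near_eq_cvg; apply: nearW => n /=.
by congr (_ / _); apply: eq_bigr => i _; rewrite -iterSr iterS.
Qed.

Definition frequency_content (A : set (clopen_space Z)) : \bar R :=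
  (frequency A)%:E.

Lemma frequency_content0 : frequency_content set0 = 0%E.
Proof. by rewrite /frequency_content frequency0. Qed.

Lemma frequency_content_ge0 (A : set (clopen_space Z)) :
  (0 <= frequency_content A)%E.
Proof.
by rewrite lee_fin frequency_ge0.
Qed.

(** By compactness only finitely many of the disjoint sets are nonempty, so finite additivity
    suffices. *)
Lemma frequency_content_sigma_additive : semi_sigma_additive frequency_content.
Proof.
move=> F mF tF mUF.
have [N FN] := clopen_trivIset_finite mF tF mUF.
have FE n : (N <= n)%N -> \bigcup_i F i = \big[setU/set0]_(i < n) F i.
  move=> Nn; rewrite -bigcup_mkord; apply/seteqP; split=> x [i];
    last by exists i.
  move=> _ Fix; exists i => //=; rewrite ltnNge; apply/negP => ni.
  by move: Fix; rewrite FN // (leq_trans Nn).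
apply: cvg_near_cst; exists N => // n /= Nn; rewrite (FE n) // {Nn}.
rewrite big_mkord.
have clU m : clopen_set (\big[setU/set0]_(i < m) F i).
  by elim/big_ind : _ => *; [exact: clopen_set0|exact: clopen_setU|exact: mF].
elim: n => [|n IH]; first by rewrite !big_ord0 frequency_content0.
rewrite !big_ord_recr /= IH /frequency_content -EFinD frequencyU //.
- exact: clU.
- exact: mF.
- apply/seteqP; split=> x // [+ Fnx]; rewrite -bigcup_mkord => -[i /= im Fix].
  by have ij : i = n by [apply: (tF i n) => //; exists x];
    rewrite ij ltnn in im.
Qed.

HB.instance Definition _ := isMeasure.Build _ _ _ frequency_content
  frequency_content0 frequency_content_ge0 frequency_content_sigma_additive.

(** The type on which the extension theorem yields a measure. Its measurable sets are generated by
    the clopen sets, hence are the Borel sets by [borel_sigma_clopen]. *)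
Let I : measurableType _ :=
  g_sigma_algebraType (@measurable _ (clopen_space Z)).

Definition frequency_measure (A : set (borel T)) : \bar R :=
  measure_extension frequency_content (A : set I).

Lemma frequency_measure0 : frequency_measure set0 = 0%E.
Proof. exact: measure0. Qed.

Lemma frequency_measure_ge0 A : (0 <= frequency_measure A)%E.
Proof. exact: measure_ge0. Qed.

Lemma frequency_measure_sigma_additive : semi_sigma_additive frequency_measure.
Proof.
move=> F mF tF mUF.
have mI A : measurable (A : set (borel T)) -> measurable (A : set I).
  by move=> /borel_sigma_clopen.
apply: (@measure_semi_sigma_additive _ I R (measure_extension
  frequency_content)) => //.
- by move=> i; apply: mI.
- exact: mI.
Qed.

HB.instance Definition _ := isMeasure.Build _ _ _ frequency_measure
  frequency_measure0 frequency_measure_ge0 frequency_measure_sigma_additive.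

Lemma frequency_measure_clopen A : clopen_set A ->
  frequency_measure A = (frequency A)%:E.
Proof.
by move=> clA; rewrite /frequency_measure /measure_extension measurable_mu_extE.
Qed.

Lemma frequency_measureT : frequency_measure setT = 1%E.
Proof. by rewrite frequency_measure_clopen ?frequencyT //;
  exact: (@measurableT _ (clopen_space Z)). Qed.

HB.instance Definition _ := Measure_isProbability.Build _ _ _ frequency_measure
  frequency_measureT.

(** The clopen sets are closed under intersection and generate the Borel sets. *)
Lemma eq_clopen_probability (m1 m2 : {measure set (borel T) -> \bar R}) :
  m1 setT = 1%E ->
  (forall A : set (borel T), clopen_set A -> m1 A = m2 A) ->
  forall A : set (borel T), measurable A -> m1 A = m2 A.
Proof.
move=> m11 m12 A mA.
apply: (@measure_unique _ R (borel T) (@clopen_set _ Z) (fun=> setT) _ _ _ _ m1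
  m2) => //.
- by apply/seteqP; split=> B /borel_sigma_clopen.
- by move=> B C; exact: (@measurableI _ (clopen_space Z)).
- move=> _; exact: (@measurableT _ (clopen_space Z)).
- by rewrite bigcup_const //; exists 0%N.
- by move=> _; rewrite m11 ltry.
Qed.

Lemma frequency_measure_invariant : invariant_measure f frequency_measure.
Proof.
move=> A mA; have mf := @shift_on_measurable _ Z.
apply: (@eq_clopen_probability (pushforward frequency_measure (f : borel T ->
  borel T)) frequency_measure) => //.
  exact: frequency_measureT.
move=> B clB; rewrite /= /pushforward frequency_measure_clopen //;
  last exact: clopen_preimage_shift.
by rewrite frequency_shift // frequency_measure_clopen.
Qed.

Lemma clopen_measurable A : clopen_set A -> measurable (A : set (borel T)).
Proof. by move=> clB; apply/borel_sigma_clopen; exact: sub_sigma_algebra. Qed.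

(** By invariance the integral of [visits A n] is [n] times the measure of [A], whereas for large
    [n] the integrand is everywhere at most [(frequency A + e) * n]. *)
Lemma invariant_measure_le_frequency (nu : probability (borel T) R) :
  invariant_measure f nu ->
  forall A : set (borel T), clopen_set A -> (nu A <= (frequency A)%:E)%E.
Proof.
move=> inv A clA; have mcl := clopen_measurable.
have fin : nu A \is a fin_num by apply: fin_num_measure; exact: mcl.
have cliter i : @clopen_set _ Z (iter i f @^-1` A).
  elim: i => [|i IH] //.
  by have := clopen_preimage_shift IH; congr clopen_set; apply/seteqP;
    split=> x /=; rewrite -iterSr.
have nuiter i : nu (iter i f @^-1` A) = nu A.
  elim: i => // i IH; rewrite -[RHS]IH -(inv _ (mcl _ (cliter i))).
  by congr (nu _); apply/seteqP; split=> x /=; rewrite -iterSr.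
have mind i : measurable_fun setT (\1_(iter i f @^-1` A) : borel T -> R).
  by apply: measurable_indic; exact: mcl.
have intE n : (\int[nu]_x (visits A n x)%:E = (fine (nu A) * n%:R)%:E)%E.
  under eq_integral do rewrite /visits -sumEFin.
  rewrite ge0_integral_sum //; last first.
    move=> i; apply/measurable_EFinP.
    exact: mind.
  rewrite (eq_bigr (fun=> nu A)); last first.
    move=> i _; rewrite -(nuiter i).
    by rewrite (@integral_indic _ _ _ nu setT measurableT (iter i f @^-1` A))
      ?setIT //; exact: mcl.
  by rewrite -(fineK fin) sumEFin sumr_const card_ord mulr_natr.
rewrite -(fineK fin) lee_fin; apply/ler_addgt0Pr => e e0.
(* One length is enough; [N.+1] is positive, so it can be cancelled. *)
have [N /(_ N.+1 _ (leqnSn N)) NP] := frequencyP clA e0.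
rewrite -(ler_pM2r (ltr0Sn R N)) -lee_fin -intE.
have -> : (((frequency A + e) * N.+1%:R)%:E =
    \int[nu]_x (cst ((frequency A + e) * N.+1%:R)%:E x))%E.
  rewrite integral_cst // [X in (_ * X)%E](_ : _ = 1%E) ?mule1 //.
  exact: probability_setT.
apply: ge0_le_integral => //.
- by move=> x _; rewrite lee_fin; apply: sumr_ge0 => i _; rewrite indicE.
- apply/measurable_EFinP; apply: measurable_sum => i.
  exact: mind.
- by move=> x _; rewrite lee_fin; have := NP x; rewrite ler_norml => /andP[_];
  lra.
Qed.

(** The upper bound, applied to the complement, is the missing lower bound. *)
Lemma invariant_measure_clopen (nu : probability (borel T) R) :
  invariant_measure f nu ->
  forall A : set (borel T), clopen_set A -> nu A = (frequency A)%:E.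
Proof.
move=> inv A clA; apply/eqP; rewrite eq_le invariant_measure_le_frequency //=.
have clCA := clopen_setC clA.
have := invariant_measure_le_frequency inv clCA.
have := frequencyU clA clCA (setICr A).
rewrite setUCr frequencyT => /esym /eqP;
  rewrite addrC eq_sym -subr_eq => /eqP <-.
rewrite probability_setC; last exact: clopen_measurable.
have fin : nu A \is a fin_num by apply: fin_num_measure;
  exact: clopen_measurable.
by rewrite -(fineK fin) -EFinB !lee_fin; lra.
Qed.

Theorem uniform_frequencies_uniquely_ergodic : uniquely_ergodic R f.
Proof.
exists frequency_measure; first exact: frequency_measure_invariant.
move=> nu inv; apply: eq_clopen_probability; first exact: probability_setT.
move=> A clA; apply: etrans (invariant_measure_clopen inv clA) _.
by apply/esym; exact: frequency_measure_clopen.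
Qed.

End UniqueErgodicity.

(** * Block structure of a sequence *)

Lemma int_step_ind (P : int -> Prop) : P 0 -> (forall k : int, P k ->
  P (k + 1)) ->
  (forall k : int, P (k + 1) -> P k) -> forall k, P k.
Proof.
move=> P0 PS PP k; suff H n : P n%:Z /\ P (- n%:Z).
  by case: (intP k) => [|n|n]; [|exact: (H _).1|exact: (H _).2].
elim: n => [|n [IH1 IH2]]; first by rewrite oppr0.
split; first by rewrite -addn1 PoszD; exact: PS.
by apply: PP; have -> : - n.+1%:Z + 1 = - n%:Z by lia.
Qed.

(* The function vanishing at 0 with increments g k = F (k + 1) - F k. *)
Definition isum (V : zmodType) (g : int -> V) (k : int) : V :=
  match k with
  | Posz n => \sum_(i < n) g i%:Z
  | Negz n => - \sum_(i < n.+1) g (- i.+1%:Z)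
  end.

Lemma isum0 (V : zmodType) (g : int -> V) : isum g 0 = 0.
Proof. exact: big_ord0. Qed.

Lemma isumS (V : zmodType) (g : int ->
  V) (k : int) : isum g (k + 1) = isum g k + g k.
Proof.
case: k => [n|[|n]]; first by rewrite -PoszD addn1 /= big_ord_recr.
- have -> : Negz 0 + 1 = 0 by [].
  by rewrite isum0 /= big_ord1 addNr.
- have -> : Negz n.+1 + 1 = Negz n by lia.
  rewrite /= [in RHS]big_ord_recr /= opprD NegzE subrK //.
Qed.

Arguments isum : simpl never.

Lemma isum_unique (V : zmodType) (g F : int -> V) :
  (forall k : int, F (k + 1) = F k + g k) -> forall k, F k = F 0 + isum g k.
Proof.
move=> FS; apply: int_step_ind => [|k IH|k]; first by rewrite isum0 addr0.
  by rewrite FS isumS IH addrA.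
by rewrite FS isumS addrA => /addIr.
Qed.

Definition flip (s : symbol) : symbol := if s is Three then One else Three.
Definition sg (s : symbol) : int := if s is Three then 1 else -1.
Definition len (s : symbol) : int := if s is Three then 3 else 1.

Lemma len_sg s : len s = 2 + sg s. Proof. by case: s. Qed.
Lemma sg_neq s t : s <> t -> sg t = - sg s. Proof. by case: s; case: t. Qed.
Lemma sg_inj : injective sg. Proof. by do 2!case. Qed.
Lemma sg_pm s : sg s = 1 \/ sg s = -1. Proof. by case: s; [right|left]. Qed.
Lemma len_pm s : len s = 1 \/ len s = 3. Proof. by case: s; [left|right]. Qed.

Section IncreasingCover.
Variable b : int -> int.
Hypothesis b_lt : forall k : int, b k < b (k + 1).

Lemma increasing_mono (i j : int) : i < j -> b i < b j.
Proof.
move=> ij; have -> : j = i + Posz (absz (j - i - 1)%R) + 1 by lia.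
elim: (absz _) => [|n IH]; first by rewrite addr0; exact: b_lt.
by apply: lt_trans IH _; rewrite -addn1 PoszD addrA; exact: b_lt.
Qed.

Lemma increasing_cover (p : int) : b 0 <= 0 < b 1 ->
  exists k, b k <= p < b (k + 1).
Proof.
move=> b0; elim/int_step_ind: p => [|p [k kP]|p [k kP]].
- by exists 0; rewrite add0r.
- have [lt_p|le_p] := ltP (p + 1) (b (k + 1)); first by exists k; lia.
  by exists (k + 1); have := b_lt (k + 1); lia.
- have [le_p|lt_p] := leP (b k) p; first by exists k; lia.
  by exists (k - 1); have := b_lt (k - 1); rewrite subrK; lia.
Qed.

Lemma increasing_cover_unique (p i k : int) :
  b i <= p < b (i + 1) -> b k <= p < b (k + 1) -> i = k.
Proof.
move=> iP kP; have [lt_ik|lt_ki|//] := ltgtP i k; exfalso.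
- have [/increasing_mono|E] : i + 1 < k \/ i + 1 = k by lia.
    by lia.
  by rewrite E in iP; lia.
- have [/increasing_mono|E] : k + 1 < i \/ k + 1 = i by lia.
    by lia.
  by rewrite E in kP; lia.
Qed.

End IncreasingCover.

Section BlockStarts.
Variable T : Type.
Implicit Types (x : int -> T) (b : int -> int).

Lemma block_starts_mono x b : is_block_starts x b ->
  forall i j : int, i < j -> b i < b j.
Proof.
by move=> [_ bP]; apply: increasing_mono => k; case: (bP k).
Qed.

Lemma block_starts_prev x b : is_block_starts x b ->
  forall k : int, x (b k - 1) <> x (b k).
Proof.
move=> [_ bP] k; have [] := bP (k - 1); rewrite subrK => lt_b cst ne.
rewrite cst; last by lia.
by move=> /esym.
Qed.

(** A block starts where the symbol changes. The later of two distinct starts would lie inside a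
    block of the other sequence, where nothing changes. Having two sequences here serves both the
    uniqueness of block starts and their dependence on finitely many coordinates. *)
Lemma block_starts_eq x x' b b' (j k : int) : is_block_starts x b ->
  is_block_starts x' b' ->
  b' j < b (k + 1) -> b k < b' (j + 1) ->
  (forall i : int, b k - 1 <= i < b (k + 1) -> x i = x' i) -> b k = b' j.
Proof.
move=> bx bx' lt1 lt2 xx'.
have [_ cst _] := bx.2 k; have [_ cst' _] := bx'.2 j.
have p := block_starts_prev bx (k := k).
have p' := block_starts_prev bx' (k := j).
have [lt_b|lt_b|//] := ltgtP (b k) (b' j); exfalso.
- apply: p'; have [xx1 xx2] : x (b' j - 1) = x' (b' j - 1) /\ x (b' j) =
  x' (b' j).
    by split; apply: xx'; lia.
  by rewrite -xx1 -xx2 (cst (b' j - 1)) ?(cst (b' j)) //; lia.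
- apply: p; have [xx1 xx2] : x (b k - 1) = x' (b k - 1) /\ x (b k) = x' (b k).
    by split; apply: xx'; case: (bx.2 k) => ? _ _; lia.
  by rewrite xx1 xx2 (cst' (b k - 1)) ?(cst' (b k)) //; lia.
Qed.

Lemma block_starts_next_eq x x' b b' (j k : int) :
  is_block_starts x b -> is_block_starts x' b' -> b k = b' j ->
  (forall i : int, b k <= i <= b (k + 1) -> x i = x' i) ->
    b (k + 1) = b' (j + 1).
Proof.
move=> bx bx' bk xx'.
have [ltk cst ne] := bx.2 k; have [ltj cst' ne'] := bx'.2 j.
have [lt_b|lt_b|//] := ltgtP (b (k + 1)) (b' (j + 1)); exfalso.
- by apply: ne; rewrite !xx' ?[LHS]cst' ?bk //; lia.
- by apply: ne'; rewrite -!xx' ?[LHS]cst -?bk //; lia.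
Qed.

Lemma is_block_starts_unique x b b' :
  is_block_starts x b -> is_block_starts x b' -> b = b'.
Proof.
move=> bx bx'; apply/funext; apply: int_step_ind => [|k IH|k IH].
- have [b0 b'0] := (bx.1, bx'.1).
  by apply: (block_starts_eq bx bx'); rewrite ?add0r //; lia.
- exact: (block_starts_next_eq bx bx').
- have [ltk _ _] := bx.2 k; have [ltk' _ _] := bx'.2 k.
  by apply: (block_starts_eq bx bx') => //; lia.
Qed.

Lemma block_startP x : finite_blocks x -> is_block_starts x (block_start x).
Proof. by move=> [b bx]; rewrite /block_start; case: xgetP => // /(_ b). Qed.

Lemma block_startE x b : is_block_starts x b -> block_start x = b.
Proof.
move=> bx; apply: (is_block_starts_unique _ bx); apply: block_startP.
by exists b.
Qed.

Definition block_index x (p : int) : int :=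
  xget 0 [set k | block_start x k <= p < block_start x (k + 1)].

Lemma block_indexP x (p : int) : finite_blocks x ->
  block_start x (block_index x p) <= p < block_start x (block_index x p + 1).
Proof.
move=> /block_startP [b0 bP]; rewrite /block_index; case: xgetP => [_ _ //|].
have [|k kP /(_ k)//] := increasing_cover _ p b0.
by move=> k; case: (bP k).
Qed.

Lemma block_index_unique x (p k : int) : finite_blocks x ->
  block_start x k <= p < block_start x (k + 1) -> block_index x p = k.
Proof.
move=> fx kP; have [_ bP] := block_startP fx.
by apply: increasing_cover_unique (block_indexP p fx) kP => j; case: (bP j).
Qed.

End BlockStarts.

(** * Signs and positions of the blocks of a differentiable sequence *)

Local Notation D := differentiable13.
Local Notation "'Δ'" := derivative13.
Implicit Types (x y : int -> symbol).

Lemma block_startS x (k : int) : D x ->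
  block_start x (k + 1) = block_start x k + len (Δ x k).
Proof.
move=> [fx /(_ k)]; have [_ /(_ k)[lt_b _ _]] := block_startP fx.
by rewrite /derivative13 /block_length => -[] E; rewrite E /=; lia.
Qed.

Definition block_sign x (k : int) : int := sg (x (block_start x k)).

Lemma block_sign_pm x k : block_sign x k = 1 \/ block_sign x k = -1.
Proof. exact: sg_pm. Qed.

Lemma block_signS x (k : int) : finite_blocks x ->
  block_sign x (k + 1) = - block_sign x k.
Proof.
move=> /block_startP [_ /(_ k)[_ _ ne]]; apply: sg_neq.
by move=> /esym.
Qed.

(** Here the oddness of the block lengths enters. *)
Lemma block_sign_len x (k : int) s : finite_blocks x ->
  block_sign x (k + len s) = - block_sign x k.
Proof.
move=> fx; case: s => /=; first exact: block_signS.
have -> : k + 3 = k + 1 + 1 + 1 by lia.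
by rewrite !block_signS // opprK.
Qed.

Lemma block_cst x (k p : int) : finite_blocks x ->
  block_start x k <= p < block_start x (k + 1) -> x p = x (block_start x k).
Proof. by move=> /block_startP [_ /(_ k)[_ + _]]; apply. Qed.

Lemma sg_block_index x (p : int) : finite_blocks x ->
  sg (x p) = block_sign x (block_index x p).
Proof.
move=> fx; rewrite /block_sign; congr sg; apply: block_cst => //.
exact: block_indexP.
Qed.

Lemma block_start0_bounds x : D x -> -2 <= block_start x 0 <= 0.
Proof.
move=> Dx; have [+ _] := block_startP Dx.1.
have := block_startS 0 Dx; rewrite add0r => ->.
by have := len_pm (Δ x 0); lia.
Qed.

Lemma block_index0 x : finite_blocks x -> block_index x 0 = 0.
Proof.
by move=> fx; apply: block_index_unique; rewrite ?add0r //;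
  case: (block_startP fx).
Qed.

Lemma block_start_bounds x (n : nat) : D x ->
  n%:Z - 2 <= block_start x n%:Z <= 3 * n%:Z /\
  - 3 * n%:Z - 2 <= block_start x (- n%:Z) <= - n%:Z.
Proof.
move=> Dx; elim: n => [|n [IH1 IH2]].
  have E : - Posz 0 = (0 : int) by [].
  by have := block_start0_bounds Dx; rewrite E -[Posz 0]/(0 : int); lia.
have := block_startS n%:Z Dx; have := block_startS (- n.+1%:Z) Dx.
have -> : - n.+1%:Z + 1 = - n%:Z by lia.
have -> : n%:Z + 1 = n.+1%:Z by lia.
by have := len_pm (Δ x n%:Z); have := len_pm (Δ x (- n.+1%:Z)); lia.
Qed.

Lemma block_index_bounds x (p : int) : D x -> 0 <= p ->
  [/\ 0 <= block_index x p, block_index x p <= p + 2 & p <=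
    3 * block_index x p + 2].
Proof.
move=> Dx p0; have bP := block_indexP p Dx.1.
have [b0 _] := block_startP Dx.1.
set k := block_index x p in bP *.
have k0 : 0 <= k.
  rewrite leNgt; apply/negP => k0.
  have [lt_k|k1] : k + 1 < 0 \/ k + 1 = 0 by lia.
    have : block_start x (k + 1) < block_start x 0.
      exact: (block_starts_mono (block_startP Dx.1)).
    by lia.
  by rewrite k1 in bP; lia.
have kE : k = (absz k)%:Z by lia.
have := block_start_bounds (absz k) Dx; rewrite -kE => -[b1 _].
have := block_start_bounds (absz k).+1 Dx.
have -> : (absz k).+1%:Z = k + 1 by lia.
by move=> [b2 _]; split=> //; lia.
Qed.

Definition translate (p : int) x : int -> symbol := fun n => x (n + p).

Lemma block_starts_translate x b (p k : int) : is_block_starts x b ->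
  b k <= p < b (k + 1) -> is_block_starts (translate p x) (fun j =>
    b (j + k) - p).
Proof.
move=> [_ bP] kp; split=> [|j].
  have -> : 1 + k = k + 1 by lia.
  have -> : 0 + k = k by lia.
  by lia.
have -> : j + 1 + k = j + k + 1 by lia.
have [lt_b cst ne] := bP (j + k); rewrite /translate !subrK; split=> //.
  by lia.
by move=> i ij; apply: cst; lia.
Qed.

Lemma block_start_translate x (p : int) : finite_blocks x ->
  block_start (translate p x) = fun j =>
    block_start x (j + block_index x p) - p.
Proof.
move=> fx; apply: block_startE; apply: block_starts_translate.
  exact: block_startP.
exact: block_indexP.
Qed.

Lemma block_length_translate x (p k : int) : finite_blocks x ->
  block_length (translate p x) k = block_length x (k + block_index x p).
Proof.
move=> fx; rewrite /block_length block_start_translate //; congr absz.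
have -> : k + 1 + block_index x p = k + block_index x p + 1 by lia.
by lia.
Qed.

Lemma differentiable_translate x (p : int) : D x -> D (translate p x).
Proof.
move=> [fx xP]; split=> [|k]; last by rewrite block_length_translate.
exists (fun j => block_start x (j + block_index x p) - p).
by apply: block_starts_translate; [exact: block_startP|exact: block_indexP].
Qed.

Lemma derivative_translate x (p : int) : finite_blocks x ->
  Δ (translate p x) = translate (block_index x p) (Δ x).
Proof.
by move=> fx; apply/funext => k; rewrite /derivative13 block_length_translate.
Qed.

Definition smooth x := forall n, D (iter n Δ x).

Lemma smooth_derivative x : smooth x -> smooth (Δ x).
Proof. by move=> sx n; rewrite -iterSr; exact: (sx n.+1). Qed.

Lemma smooth_iter x n : smooth x -> smooth (iter n Δ x).
Proof. by move=> sx m; rewrite -iterD. Qed.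

(** This is the count N_n of the sketch: at each level the block containing position 0 has number 0,
    so the number of the block containing [p] counts the blocks in between. *)
Fixpoint level_index x (n : nat) (p : int) : int :=
  if n is n'.+1 then block_index (iter n' Δ x) (level_index x n' p) else p.

Lemma iter_derivative_translate x n (p : int) : smooth x ->
  iter n Δ (translate p x) = translate (level_index x n p) (iter n Δ x).
Proof.
move=> sx; elim: n => //= n ->; apply: derivative_translate.
by case: (sx n).
Qed.

Lemma smooth_translate x (p : int) : smooth x -> smooth (translate p x).
Proof.
by move=> sx n; rewrite iter_derivative_translate //;
  exact: differentiable_translate.
Qed.

(* +1 for type 0 and -1 for type 1: as block lengths are odd, passing from
   one block of [Δ x] to the next changes the sign of both factors. *)
Definition kappa x : int := block_sign x (block_start (Δ x) 0) * sg (Δ x 0).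

Lemma kappaE x (i : int) : D x -> D (Δ x) ->
  block_sign x (block_start (Δ x) i) * block_sign (Δ x) i = kappa x.
Proof.
move=> Dx Dy; have [fx _] := Dx; have [fy _] := Dy.
have S (j : int) : block_sign x (block_start (Δ x) (j + 1)) * block_sign (Δ x)
  (j + 1) =
    block_sign x (block_start (Δ x) j) * block_sign (Δ x) j.
  by rewrite block_startS // block_sign_len // block_signS // mulrNN.
elim/int_step_ind: i => [|i <-|i]; last by rewrite S.
- by rewrite /kappa (sg_block_index 0 fy) block_index0.
- exact: S.
Qed.

Lemma kappa_pm x : kappa x = 1 \/ kappa x = -1.
Proof.
rewrite /kappa; have := sg_pm (Δ x 0).
by have := block_sign_pm x (block_start (Δ x) 0) => -[] -> [] ->;
  rewrite ?mulr1 ?mul1r ?mulrNN; auto.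
Qed.

Lemma kappa_translate x (p : int) : D x -> D (Δ x) ->
  kappa (translate p x) = kappa x.
Proof.
move=> Dx Dy; have [fx _] := Dx; have [fy _] := Dy.
have DTy : D (Δ (translate p x)).
  by rewrite derivative_translate //; exact: differentiable_translate.
rewrite -(kappaE 0 (differentiable_translate p Dx) DTy).
rewrite -(kappaE (block_index (Δ x) (block_index x p)) Dx Dy) /block_sign.
by rewrite derivative_translate // !block_start_translate // /translate !subrK
  add0r.
Qed.

Lemma isum_lip (g : int -> int) : (forall k, `|g k| <= 1) ->
  forall (k : int) (r : nat), `|isum g (k + r%:Z) - isum g k| <= r%:Z.
Proof.
move=> g1 k; elim=> [|r IH]; first by rewrite addr0 subrr normr0.
have -> : k + r.+1%:Z = k + r%:Z + 1 by lia.
by rewrite isumS; have := g1 (k + r%:Z); lia.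
Qed.

(** The alternating sum is bounded; doubling makes it a telescoping sum of integers. *)
Lemma isum_sign x (k : int) : finite_blocks x ->
  isum (block_sign x) k *+ 2 = block_sign x 0 - block_sign x k.
Proof.
move=> fx; elim/int_step_ind: k => [|k IH|k].
- by rewrite isum0 subrr.
- by rewrite isumS block_signS // mulrnDl IH; lia.
- by rewrite isumS block_signS // mulrnDl; lia.
Qed.

Definition type_sign (t : bool) : int := if t then -1 else 1.

Lemma type_sign_inj : injective type_sign. Proof. by do 2!case. Qed.

Lemma derivative_threeP x (k : int) : D x ->
  Δ x k = Three <-> block_length x k = 3%N.
Proof. by move=> [_ /(_ k)] []; rewrite /derivative13 => ->; split. Qed.

(** Adjacent mono-symbol blocks of [Δ x] carry different symbols, so one of any two consists of
    threes. *)
Lemma exists_block_three x : D x -> D (Δ x) -> exists j, block_length x j = 3%N.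
Proof.
move=> Dx [fy _]; have [_ /(_ 0)[_ _ ne]] := block_startP fy.
have [|y0] := EM (Δ x (block_start (Δ x) 0) = Three).
  by move=> y3; exists (block_start (Δ x) 0); apply/derivative_threeP.
exists (block_start (Δ x) (0 + 1)); apply/derivative_threeP => //.
by move: ne y0; case: (Δ x _) => //; case: (Δ x _).
Qed.

(** A letter records the symbol and the length of a block of [x]. The product of their signs is +1
    for [LA] and [LD] and -1 for [LB] and [LC]; at the first letter of an elementary block it equals
    [kappa x]. *)
Lemma has_typeE x t : smooth x -> has_type x t <-> kappa x = type_sign t.
Proof.
move=> sx; have Dx : D x := sx 0%N; have Dw : D (Δ x) := sx 1%N.
have Dv : D (Δ (Δ x)) := sx 2%N.
split.
  move=> [j]; rewrite -(kappaE j Dx Dw) /block_sign /elementary_block.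
  case: (block_length _ j) => [|n] /=; first by case: t => -[].
  rewrite addr0 /recoding /code.
  by case: t => -[] []; case: (x _) => //; case: (Δ x _).
(* The patterns have three letters, so a mono-symbol block of length 3 in [Δ x] has to be found
   first. *)
move=> kt; have [j j3] := exists_block_three Dw Dv.
have fx := Dx.1; have fw := Dw.1.
exists j; rewrite /elementary_block j3 /= addr0.
set K := block_start (Δ x) j.
have bS : block_start (Δ x) (j + 1) = K + 3.
  by rewrite block_startS // (derivative_threeP j Dw).2.
have w1 : Δ x (K + 1) = Δ x K by apply: (@block_cst _ j) => //; rewrite bS /K;
  lia.
have w2 : Δ x (K + 2%:Z) = Δ x K by apply: (@block_cst _ j) => //;
  rewrite bS /K; lia.
have s1 := block_signS K fx.
have s2 := block_signS (K + 1) fx.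
have K2 : K + 1 + 1 = K + 2%:Z by lia.
rewrite K2 s1 in s2.
move: kt s1 s2; rewrite -(kappaE j Dx Dw) -/K /recoding w1 w2 /block_sign -/K.
by case: t; case: (x _); case: (x _) => //; case: (x _) => //;
  case: (Δ x K) => //; auto.
Qed.

(** * Linear relations between the numbers of blocks at successive levels *)

Lemma isum_near (g : int -> int) : (forall k, `|g k| <= 1) ->
  forall (k l : int), l <= k <= l + 3 -> `|isum g k - isum g l| <= 3.
Proof.
move=> g1 k l kl; have -> : k = l + (absz (k - l)%R)%:Z by lia.
by have := isum_lip g1 l (absz (k - l)%R); lia.
Qed.

(* Over a block of [Δ x] the summand alternates and the length is odd, so each
   block contributes exactly [kappa x]. *)
Lemma isum_sign_derivative x (k : int) : D x -> D (Δ x) -> D (Δ (Δ x)) ->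
  `|isum (fun i => block_sign x i * sg (Δ x i)) k
    - kappa x * block_index (Δ x) k| <= 6.
Proof.
move=> Dx Dy Dw; set y := Δ x in Dy Dw *; set g := fun i => _; set h := isum g.
have fx := Dx.1; have fy := Dy.1.
have g1 i : `|g i| <= 1.
  by rewrite /g; case: (sg_pm (y i)); case: (block_sign_pm x i) => -> ->.
have hS (i : int) : h (block_start y (i + 1)) = h (block_start y i) + kappa x.
  have bS := block_startS i Dy; have := kappaE i Dx Dy; rewrite -/y => kE.
  set K := block_start y i in bS kE *.
  have [l1|l3] := len_pm (Δ y i); rewrite bS ?l1 ?l3.
    by rewrite /h isumS; congr (_ + _); rewrite -kE.
  have -> : K + 3 = K + 1 + 1 + 1 by lia.
  rewrite /h !isumS /g !block_signS // -kE.
  have -> : y (K + 1) = y K by apply: (@block_cst _ i) => //;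
    rewrite bS l3 /K; lia.
  have -> : y (K + 1 + 1) = y K by apply: (@block_cst _ i) => //;
    rewrite bS l3 /K; lia.
  by rewrite /block_sign -/K; lia.
have hE (i : int) : h (block_start y i) = h (block_start y 0) + kappa x * i.
  by elim/int_step_ind: i => [|i IH|i];
    rewrite ?mulr0 ?addr0 ?hS ?IH ?mulrDr ?mulr1; lia.
have iP := block_indexP k fy; set i := block_index y k in iP *.
have := block_startS i Dy; have := len_pm (Δ y i) => ln bS.
have h1 : `|h k - h (block_start y i)| <= 3 by apply: isum_near => //; lia.
have h2 : `|isum g 0 - h (block_start y 0)| <= 3.
  by apply: isum_near => //; have := block_start0_bounds Dy; lia.
by rewrite isum0 in h2; have := hE i; lia.
Qed.

(* A block of [y] contributes [sign * (2 + sg length)], and the terms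
   [2 * sign] telescope because the signs alternate. *)
Lemma isum_sg_block_start y (j : int) : D y ->
  isum (fun i => sg (y i)) (block_start y j) + block_sign y j =
  isum (fun i => sg (y i)) (block_start y 0) + block_sign y 0 +
  isum (fun i => block_sign y i * sg (Δ y i)) j.
Proof.
move=> Dy; have fy := Dy.1.
pose F j := isum (fun i => sg (y i)) (block_start y j) + block_sign y j.
suff FS (i : int) : F (i + 1) = F i + block_sign y i * sg (Δ y i).
  by have := isum_unique FS j.
rewrite /F; have bS := block_startS i Dy; rewrite bS block_signS //.
set K := block_start y i in bS *.
have yK : sg (y K) = block_sign y i by [].
have [E|E] : Δ y i = One \/ Δ y i = Three by case: (Δ y i); auto.
  by rewrite E /= isumS yK; lia.
have E3 : len (Δ y i) = 3 by rewrite E.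
have y1 : y (K + 1) = y K by apply: (@block_cst _ i) => //; rewrite bS E3 /K;
  lia.
have y2 : y (K + 1 + 1) = y K by apply: (@block_cst _ i) => //;
  rewrite bS E3 /K; lia.
rewrite E /=; have -> : K + 3 = K + 1 + 1 + 1 by lia.
by rewrite !isumS y1 y2 yK; lia.
Qed.

(** [isum_sg_block_start] reduces the sum to that of [isum_sign_derivative]. The bound 14 is 6 from
    there, 3 + 3 for moving both ends to block starts, and 2 for the two block signs. *)
Lemma isum_sg y (k : int) : D y -> D (Δ y) -> D (Δ (Δ y)) ->
  `|isum (fun i => sg (y i)) k
    - kappa y * block_index (Δ y) (block_index y k)| <= 14.
Proof.
move=> Dy Dw Dv; have fy := Dy.1.
have g1 i : `|sg (y i)| <= 1 by case: (y i).
have iP := block_indexP k fy; set i := block_index y k in iP *.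
have := block_startS i Dy; have := len_pm (Δ y i) => ln bS.
have h1 := isum_near g1 (k := k) (l := block_start y i).
have h2 := isum_near g1 (k := 0) (l := block_start y 0).
have := block_start0_bounds Dy => b0; rewrite isum0 in h2.
have := isum_sign_derivative i Dy Dw Dv; have := isum_sg_block_start i Dy.
by have := block_sign_pm y i; have := block_sign_pm y 0; lia.
Qed.

Lemma block_start_isum x (k : int) : D x ->
  block_start x k = block_start x 0 + k *+ 2 + isum (fun i => sg (Δ x i)) k.
Proof.
move=> Dx; elim/int_step_ind: k => [|k IH|k]; first by rewrite isum0; lia.
  by rewrite block_startS // len_sg isumS IH; lia.
by rewrite block_startS // len_sg isumS; lia.
Qed.

(** The recurrence N_0 = 2 N_1 +- N_3 + O(1): block [k] of [x] has length [2 + sg (Δ x k)], and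
    [isum_sg] evaluates the sum of these signs. *)
Lemma drift x (p : int) : smooth x ->
  `|p - level_index x 1 p *+ 2 - kappa (Δ x) * level_index x 3 p| <= 20.
Proof.
move=> sx; have Dx : D x := sx 0%N; have Dy : D (Δ x) := sx 1%N.
have Dw : D (Δ (Δ x)) := sx 2%N; have Dv : D (Δ (Δ (Δ x))) := sx 3%N.
rewrite /= ; have iP := block_indexP p Dx.1.
set k := block_index x p in iP *.
have := block_startS k Dx; have := len_pm (Δ x k) => ln bS.
have := block_start_isum k Dx; have := isum_sg k Dy Dw Dv.
by have := block_start0_bounds Dx; lia.
Qed.

(* Every other block of [Δ x] consists of threes. *)
Lemma index_sum_le x (p : int) : smooth x -> 0 <= p ->
  level_index x 1 p + level_index x 2 p <= p + 20.
Proof.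
move=> sx p0; have Dx : D x := sx 0%N; have Dy : D (Δ x) := sx 1%N.
have fy := Dy.1.
rewrite /=; set k := block_index x p; set j := block_index (Δ x) k.
have [k0 _ _] := block_index_bounds Dx p0; rewrite -/k in k0.
have [j0 _ _] := block_index_bounds Dy k0; rewrite -/j in j0.
pose G l := l + isum (fun i => sg (Δ x i)) l.
have GS (l : int) : G l <= G (l + 1).
  by rewrite /G isumS; case: (sg_pm (Δ x l)) => ->; lia.
have Gmono (l : int) (n : nat) : G l <= G (l + n%:Z).
  elim: n => [|n IH]; first by rewrite addr0.
  by have -> : l + n.+1%:Z = l + n%:Z + 1 by [lia]; apply: le_trans IH (GS _).
have Gb (n : nat) : (G (block_start (Δ x) 0) + n%:Z) *+ 2 <=
    (G (block_start (Δ x) n%:Z)) *+ 2 + block_sign (Δ x) n%:Z - block_sign (Δ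
      x) 0.
  elim: n => [|n IH]; first by rewrite -[Posz 0]/(0 : int); lia.
  have -> : n.+1%:Z = n%:Z + 1 by lia.
  have bS := block_startS n%:Z Dy; have sS := block_signS n%:Z fy.
  set K := block_start (Δ x) n%:Z in bS IH *.
  have GK : G (K + 1) = G K + 1 + block_sign (Δ x) n%:Z by rewrite /G isumS
    /block_sign -/K; lia.
  have : G (K + 1) <= G (block_start (Δ x) (n%:Z + 1)).
    rewrite bS; case: (Δ (Δ x) n%:Z) => //=.
    by have -> : K + 3 = K + 1 + 2%:Z by lia.
  by have := block_sign_pm (Δ x) n%:Z; lia.
have := Gb (absz j); have -> : (absz j)%:Z = j by lia.
have := block_indexP k fy; rewrite -/j => jP.
have : G (block_start (Δ x) j) <= G k.
  have -> : k = block_start (Δ x) j + (absz (k - block_start (Δ x) j)%R)%:Z by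
    lia.
  exact: Gmono.
have g1 i : `|sg (Δ x i)| <= 1 by case: (Δ x i).
have h2 := isum_near g1 (k := 0) (l := block_start (Δ x) 0).
have := block_start0_bounds Dy => b0; rewrite isum0 in h2.
have := block_start_isum k Dx; have := block_indexP p Dx.1; rewrite -/k.
have := block_sign_pm (Δ x) j; have := block_sign_pm (Δ x) 0.
have := block_start0_bounds Dx; rewrite /G; lia.
Qed.

(** * Blocks of higher level *)


Fixpoint level_start x (n : nat) (k : int) : int :=
  if n is n'.+1 then level_start x n' (block_start (iter n' Δ x) k) else k.

Lemma level_start_mono x n (i j : int) : smooth x -> i < j ->
  level_start x n i < level_start x n j.
Proof.
move=> sx; elim: n i j => //= n IH i j ij; apply: IH.
by apply: block_starts_mono ij; apply: block_startP; case: (sx n).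
Qed.

Lemma level_start_le x n (i j : int) : smooth x -> i <= j ->
  level_start x n i <= level_start x n j.
Proof.
by move=> sx; rewrite le_eqVlt => /orP[/eqP->//|/(level_start_mono n sx)/ltW].
Qed.

Lemma level_indexP x n (p : int) : smooth x ->
  level_start x n (level_index x n p) <=
    p < level_start x n (level_index x n p + 1).
Proof.
move=> sx; elim: n => [|n IH] /=; first by lia.
set q := level_index x n p in IH *.
have := block_indexP q (sx n).1; set k := block_index _ _ => kP.
have := level_start_le n sx (i := block_start (iter n Δ x) k) (j := q).
have := level_start_le n sx (i := q + 1) (j :=
  block_start (iter n Δ x) (k + 1)).
by lia.
Qed.

Lemma level_start_len x n (k : int) : smooth x ->
  level_start x n k <= level_start x n (k + 1) <=
    level_start x n k + (3 ^ n)%N%:Z.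
Proof.
move=> sx; elim: n k => [|n IH] k; first by rewrite /= expn0; lia.
rewrite /= block_startS; last exact: sx.
set K := block_start _ _.
have := IH K; have := IH (K + 1); have := IH (K + 1 + 1).
have -> : K + 1 + 1 + 1 = K + 3 by lia.
by rewrite expnS; case: (len_pm (Δ (iter n Δ x) k)) => ->; lia.
Qed.

(* At level 0 a block is a single position, and the first component is junk. *)
Definition block_letter x (n : nat) (k : int) : symbol * symbol :=
  if n is n'.+1 then (iter n' Δ x (block_start (iter n' Δ x) k), iter n Δ x k)
  else (One, x k).

Definition same_factor x x' (a b a' b' : int) :=
  b - a = b' - a' /\ forall i : int, 0 <= i < b - a -> x (a + i) = x' (a' + i).

Lemma same_factor_cat x x' (a b c a' b' c' : int) :
  same_factor x x' a b a' b' -> same_factor x x' b c b' c' ->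
  same_factor x x' a c a' c'.
Proof.
move=> [ab xab] [bc xbc]; split=> [|i ic]; first by lia.
have [i_ab|ab_i] := ltP i (b - a); first by apply: xab; lia.
have := xbc (i - (b - a)); have -> : b + (i - (b - a)) = a + i by lia.
by have -> : b' + (i - (b - a)) = a' + i by [lia]; apply; lia.
Qed.

(* The types determine the letters of the sub-blocks: their first components
   alternate, starting with the sign [kappa]. *)
Lemma block_letter_factor x x' n (k k' : int) : smooth x -> smooth x' ->
  (forall m, kappa (iter m Δ x) = kappa (iter m Δ x')) ->
  block_letter x n k = block_letter x' n k' ->
  same_factor x x' (level_start x n k) (level_start x n (k + 1))
                   (level_start x' n k') (level_start x' n (k' + 1)).
Proof.
move=> sx sx' kx; elim: n k k' => [|n IH] k k'.
  move=> /= [xk]; split; first by lia.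
  by move=> i i01; have -> : i = 0 by [lia]; rewrite !addr0.
rewrite /=; set z := iter n Δ x; set z' := iter n Δ x'.
have Dz : D z := sx n; have Dz' : D z' := sx' n.
have Dy : D (Δ z) := sx n.+1; have Dy' : D (Δ z') := sx' n.+1.
rewrite !block_startS // => -[zK yk].
set K := block_start z k in zK *; set K' := block_start z' k' in zK *.
(* The second components of the letters are constant over the sub-blocks; only the first components
   remain to be compared. *)
have letter_cst (j : int) : 0 <= j < len (Δ z k) ->
    (forall m, n = m.+1 -> block_sign (iter m Δ x) (K + j) =
                       block_sign (iter m Δ x') (K' + j)) ->
    block_letter x n (K + j) = block_letter x' n (K' + j).
  move=> jlen signs.
  have zj : z (K + j) = z' (K' + j).
    transitivity (z K).
      by apply: (@block_cst _ k); [exact: Dz.1|rewrite block_startS // -/K;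
        lia].
    rewrite zK; apply/esym; apply: (@block_cst _ k'); first exact: Dz'.1.
    by rewrite block_startS // -/K' -yk; lia.
  move: zj signs; rewrite /block_letter /z /z'; case: (n) => [|m];
    first by move=> /= ->.
  by move=> /= -> /(_ m erefl)/sg_inj ->.
(* By [kappaE], the type and the symbol of the enclosing block fix the sign of its first
   sub-block. *)
have sign0 m : n = m.+1 ->
    block_sign (iter m Δ x) K = block_sign (iter m Δ x') K'.
  move=> nm; have /= := kappaE k (sx m) (sx m.+1).
  have /= := kappaE k' (sx' m) (sx' m.+1); rewrite -kx.
  rewrite -!iterS -nm -/z -/z' -/K -/K'.
  have -> : block_sign z k = block_sign z' k' by rewrite /block_sign -/K -/K'
    zK.
  by move=> <-; case: (block_sign_pm z' k') => ->;
    rewrite ?mulr1 ?mulrN1 => // /oppr_inj.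
have lenP : 0 <= (0 : int) < len (Δ z k) by case: (Δ z k).
have c0 : same_factor x x' (level_start x n K) (level_start x n (K + 1))
                   (level_start x' n K') (level_start x' n (K' + 1)).
  by apply: IH; have := letter_cst 0 lenP; rewrite !addr0; apply.
case: (Δ z k) (Δ z' k') yk letter_cst {lenP} => -[] // _ letter_cst.
have step (m : nat) (j j' : int) : n = m.+1 ->
  block_sign (iter m Δ x) j = block_sign (iter m Δ x') j' ->
  block_sign (iter m Δ x) (j + 1) = block_sign (iter m Δ x') (j' + 1).
  by move=> _; rewrite !block_signS => [->//||]; [case: (sx' m)|case: (sx m)].
have c1 := IH (K + 1) (K' + 1) (letter_cst 1 isT (fun m nm =>
  step _ _ _ nm (sign0 m nm))).
have c2 : same_factor x x' (level_start x n (K + 1 + 1)) (level_start x n (K +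
  1 + 1 + 1))
                   (level_start x' n (K' + 1 + 1)) (level_start x' n (K' + 1 +
                     1 + 1)).
  apply: IH; have := letter_cst 2%:Z isT.
  have -> : K + 2%:Z = K + 1 + 1 by lia.
  have -> : K' + 2%:Z = K' + 1 + 1 by lia.
  by apply=> m nm; do 2!apply: (step m _ _ nm); exact: sign0.
have -> : K + len Three = K + 1 + 1 + 1 by rewrite /=; lia.
have -> : K' + len Three = K' + 1 + 1 + 1 by rewrite /=; lia.
exact: same_factor_cat (same_factor_cat c0 c1) c2.
Qed.

(** * Birkhoff sums of local functions as linear combinations of block numbers *)

Section BirkhoffSums.
Variables (f : (int -> symbol) -> int) (m : nat).
Hypothesis f_le1 : forall x, `|f x| <= 1.
Hypothesis f_local : forall x y, @agree symbol m x y -> f x = f y.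

Definition birkhoff_sum x (p : int) : int := isum (fun i =>
  f (translate i x)) p.

Lemma birkhoff_lip x (k l : int) (n : nat) : l <= k <= l + n%:Z ->
  `|birkhoff_sum x k - birkhoff_sum x l| <= n%:Z.
Proof.
move=> kl; have -> : k = l + (absz (k - l)%R)%:Z by lia.
have := @isum_lip (fun i => f (translate i x)) (fun=> f_le1 _) l (absz (k -
  l)%R).
by rewrite /birkhoff_sum; lia.
Qed.

(** Only positions within [m] of an end of the factor see symbols outside it. There are at most
    [2 * m] of them, and each changes the difference by at most 2. *)
Lemma birkhoff_same_factor x x' (a b a' b' : int) : a <= b ->
  same_factor x x' a b a' b' ->
  `|(birkhoff_sum x b - birkhoff_sum x a) -
    (birkhoff_sum x' b' - birkhoff_sum x' a')| <= 4 * m%:Z.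
Proof.
move=> le_ab [abE xx']; pose l := absz (b - a)%R.
have -> : b = a + l%:Z by rewrite /l; lia.
have -> : b' = a' + l%:Z by rewrite /l; lia.
(* Among the first [r] positions the bound counts the first [m] and those from [l - m] on. *)
suff H r : (r <= l)%N -> `|(birkhoff_sum x (a + r%:Z) - birkhoff_sum x a) -
    (birkhoff_sum x' (a' + r%:Z) - birkhoff_sum x' a')|
    <= 2 * (minn r m + (r - (l - m)))%N%:Z.
  by have := H l (leqnn l); lia.
elim: r => [|r IH] rl; first by rewrite !addr0 !subrr normr0; lia.
have := IH (ltnW rl).
have -> : a + r.+1%:Z = a + r%:Z + 1 by lia.
have -> : a' + r.+1%:Z = a' + r%:Z + 1 by lia.
rewrite /birkhoff_sum !isumS.
have := f_le1 (translate (a + r%:Z) x);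
  have := f_le1 (translate (a' + r%:Z) x').
have [/andP[mr rlm]|out] := boolP ((m <= r) && (r < l - m))%N; last by lia.
have -> : f (translate (a + r%:Z) x) = f (translate (a' + r%:Z) x').
  apply: f_local => i im; rewrite /translate.
  have -> : i + (a + r%:Z) = a + (r%:Z + i) by lia.
  have -> : i + (a' + r%:Z) = a' + (r%:Z + i) by lia.
  by apply: xx'; rewrite /l in rlm; lia.
by lia.
Qed.

(** By [block_letter_factor], blocks with the same letter carry the same word, so their Birkhoff
    sums differ by a boundary effect only. It matters that [F] depends on the types and on the
    level, but not on [x]. *)
Lemma birkhoff_letters (eps : nat -> int) n : exists F : symbol * symbol -> int,
  forall x (Q : nat), smooth x -> (forall j, kappa (iter j Δ x) = eps j) ->
  `|birkhoff_sum x (level_start x n Q%:Z) - birkhoff_sum x (level_start x n 0)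
    - isum (fun k => F (block_letter x n k)) Q%:Z| <= 4 * m%:Z * Q%:Z.
Proof.
pose B x (k : int) := birkhoff_sum x (level_start x n (k + 1)) - birkhoff_sum x
  (level_start x n k).
have [F FP] : exists F : symbol * symbol ->
  int, forall a x (k : int), smooth x ->
    (forall j, kappa (iter j Δ x) = eps j) -> block_letter x n k = a ->
    `|B x k - F a| <= 4 * m%:Z.
  suff : forall a, exists c, forall x (k : int), smooth x ->
    (forall j, kappa (iter j Δ x) = eps j) -> block_letter x n k = a ->
    `|B x k - c| <= 4 * m%:Z by move=> /choice[F FP]; exists F.
  (* Any one block with letter [a], in any sequence of these types, provides the reference value; a
     letter that never occurs gets 0. *)
  move=> a; have [[x0 [k0 [sx0 kx0 xa]]]|none] := EM (exists x0 (k0 : int),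
    [/\ smooth x0,
     (forall j, kappa (iter j Δ x0) = eps j) & block_letter x0 n k0 = a]).
    exists (B x0 k0) => x k sx kx xka; apply: birkhoff_same_factor.
      by have := level_start_len n k sx; lia.
    apply: block_letter_factor => //; first by move=> j; rewrite kx kx0.
    by rewrite xka xa.
  exists 0 => x k sx kx xa; exfalso; apply: none; by exists x, k.
exists F => x Q sx kx; elim: Q => [|Q IH].
  by rewrite -[Posz 0]/(0 : int) isum0 subrr subr0 mulr0 normr0.
have -> : Q.+1%:Z = Q%:Z + 1 by lia.
rewrite isumS; have := FP _ x Q%:Z sx kx erefl; rewrite /B.
by lia.
Qed.

(** The Fourier expansion of a function of two signs; the factor 4 clears the denominators. *)
Lemma symbol_pair_expansion (F : symbol * symbol -> int) : exists a b c d : int,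
  forall s t, 4 * F (s, t) = a + b * sg s + c * sg t + d * (sg s * sg t).
Proof.
pose G s t := F (s, t).
exists (G One One + G One Three + G Three One + G Three Three),
  (- G One One - G One Three + G Three One + G Three Three),
  (- G One One + G One Three - G Three One + G Three Three),
  (G One One - G One Three - G Three One + G Three Three).
by case=> -[] /=; rewrite -/(G _ _); lia.
Qed.

Lemma isum_lin (a b c d : int) (g h e : int -> int) (k : int) :
  isum (fun i => a + b * g i + c * h i + d * e i) k =
  a * k + b * isum g k + c * isum h k + d * isum e k.
Proof.
have S (j : int) : a * (j + 1) + b * isum g (j + 1) + c * isum h (j + 1) +
    d * isum e (j + 1) = (a * j + b * isum g j + c * isum h j + d * isum e j) +
    (a + b * g j + c * h j + d * e j).
  by rewrite !isumS; ring.
have /= -> := isum_unique S k.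
by rewrite !isum0 !mulr0 !addr0 add0r.
Qed.

(** Of the four terms of the expansion of [F], the constant one counts the blocks of level [n.+1],
    the block sign alone has bounded sums, and [isum_sg] and [isum_sign_derivative] evaluate the
    other two. *)
Lemma birkhoff_levels (eps : nat ->
  int) n : exists a c d C : int, forall x (p : int),
  smooth x -> (forall j, kappa (iter j Δ x) = eps j) -> 0 <= p ->
  `|4 * birkhoff_sum x p - (a * level_index x n.+1 p + c * level_index x n.+3 p
     + d * level_index x n.+2 p)| <= 16 * m%:Z * level_index x n.+1 p + C.
Proof.
have [F FP] := birkhoff_letters eps n.+1.
have [a [b [c [d FE]]]] := symbol_pair_expansion F.
(* The summand [8 * 3 ^ n.+1] pays for moving both ends of the interval to block starts, the other
   summands for the errors of the sums weighted by [b], [c] and [d]. *)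
exists a, (c * eps n.+1), (d * eps n),
  (8 * (3 ^ n.+1)%N%:Z + `|b| + `|c| * 14 + `|d| * 6).
move=> x p sx kx p0.
have Q0 j : 0 <= level_index x j p.
  by elim: j => //= j IH; have [] := block_index_bounds (sx j) IH.
set Q := level_index x n.+1 p.
have QE : Q = (absz Q)%:Z by have := Q0 n.+1; rewrite -/Q; lia.
have := FP x (absz Q) sx kx; rewrite -QE.
set u := iter n Δ x.
have Du : D u := sx n; have Dz : D (Δ u) := sx n.+1.
have Dy : D (Δ (Δ u)) := sx n.+2; have Dw : D (Δ (Δ (Δ u))) := sx n.+3.
have e1 := isum_sign_derivative Q Du Dz Dy.
have e2 := isum_sg Q Dz Dy Dw.
have e3 := isum_sign Q Du.1.
have -> : level_index x n.+3 p =
  block_index (Δ (Δ u)) (block_index (Δ u) Q) by [].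
have -> : level_index x n.+2 p = block_index (Δ u) Q by [].
have ku : kappa u = eps n := kx n.
have kz : kappa (Δ u) = eps n.+1 := kx n.+1.
rewrite ku in e1; rewrite kz in e2.
set J3 := block_index (Δ (Δ u)) _ in e2 *;
  set J2 := block_index (Δ u) Q in e1 *.
have FI : 4 * isum (fun k => F (block_letter x n.+1 k)) Q =
  a * Q + b * isum (block_sign u) Q + c * isum (fun i => sg (Δ u i)) Q +
  d * isum (fun i => block_sign u i * sg (Δ u i)) Q.
  have S (k : int) : 4 * isum (fun k => F (block_letter x n.+1 k)) (k + 1) =
      4 * isum (fun k => F (block_letter x n.+1 k)) k + (a + b * block_sign u k
        +
        c * sg (Δ u k) + d * (block_sign u k * sg (Δ u k))).
    by rewrite isumS mulrDr FE.
  by rewrite -isum_lin; have /= -> := isum_unique S Q;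
    rewrite isum0 mulr0 add0r.
have l0 := birkhoff_lip x (k := 0) (l := level_start x n.+1 0) (n :=
  (3 ^ n.+1)%N).
have l1 := birkhoff_lip x (k := p) (l := level_start x n.+1 Q) (n :=
  (3 ^ n.+1)%N).
have b1 := level_indexP n.+1 p sx; rewrite -/Q in b1.
have b2 := level_start_len n.+1 Q sx.
have z1 : level_index x n.+1 0 = 0.
  elim: (n.+1) => //= j ->; apply: block_index0; exact: (sx j).1.
have b3 := level_indexP n.+1 0 sx; rewrite z1 in b3.
have b4 := level_start_len n.+1 0 sx.
have S0 : birkhoff_sum x 0 = 0 by rewrite /birkhoff_sum isum0.
rewrite S0 in l0.
have bb : `|b * isum (block_sign u) Q| <= `|b|.
  rewrite normrM ler_piMr //.
  by move: e3; case: (block_sign_pm u 0) => ->;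
    case: (block_sign_pm u Q) => ->; lia.
have cc : `|c * isum (fun i => sg (Δ u i)) Q - c * eps n.+1 * J3| <= `|c| * 14.
  by rewrite -mulrA -mulrBr normrM ler_wpM2l.
have dd : `|d * isum (fun i => block_sign u i * sg (Δ u i)) Q - d * eps n * J2|
  <= `|d| * 6.
  by rewrite -mulrA -mulrBr normrM ler_wpM2l.
move: FI bb cc dd; set I0 := isum _ _; set I1 := b * _;
  set I2 := c * isum _ _; set I3 := d * isum _ _.
move: `|b| `|c| `|d| => nb nc nd; set J4 := c * _ * _; set J5 := d * _ * _;
  set J6 := a * Q.
move: l0 l1 b1 b2 b3 b4; set P0 := level_start _ _ 0;
  set P1 := level_start _ _ Q.
set P2 := level_start _ _ (0 + 1); set P3 := level_start _ _ (Q + 1).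
set S1 := birkhoff_sum x P0; set S2 := birkhoff_sum x P1;
  set S3 := birkhoff_sum x p.
set T := (3 ^ n.+1)%N%:Z.
move=> l0 l1 b1 b2 b3 b4 FI bb cc dd FQ.
set mQ := m%:Z * Q; have -> : 16 * m%:Z * Q = 16 * mQ by rewrite mulrA.
have : 4 * m%:Z * Q = 4 * mQ by rewrite mulrA.
move=> mQE; rewrite mQE in FQ.
have {}l0 : `|0 - S1| <= T by apply: l0; lia.
have {}l1 : `|S3 - S2| <= T by apply: l1; lia.
clear b1 b2 b3 b4 e1 e2 e3.
move: l0 l1 bb cc dd FQ; rewrite !ler_norml.
move=> /andP[? ?] /andP[? ?] /andP[? ?] /andP[? ?] /andP[? ?] /andP[? ?].
by apply/andP; split; lia.
Qed.

End BirkhoffSums.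

(** * Convergence of the densities *)

Section Contraction.
Variables (R : realType) (e : nat -> R).
Hypothesis e_pm : forall n, e n = 1 \/ e n = -1.

(** The relations satisfied by the N_n of one sequence and one end point: block lengths are at most
    3, then [index_sum_le] and [drift], with a common error of 20. *)
Definition quasi_recurrent (u : nat -> R) := forall n,
  [/\ u n <= 3 * u n.+1 + 20, u n.+1 + u n.+2 <= u n + 20 &
      `|u n - 2 * u n.+1 - e n.+1 * u n.+3| <= 20].

(** The first two relations give [u n >= 4 / 3 * u n.+1] and [u n <= 3 * u n.+1] up to additive
    constants. These are absorbed in 13/10 and 301/100 because the terms are at least 2000. *)
Lemma ratio_bounds u n (h : R) : quasi_recurrent u -> 0 < h <= 1 / 100 ->
  20 / h <= u n.+1 -> 20 / h <= u n.+2 -> 13 / 10 <= u n / u n.+1 <= 301 / 100.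
Proof.
move=> uq /andP[h0 h1] un1 un2.
have T0 : 2000 <= 20 / h by rewrite ler_pdivlMr //; lra.
have [b1 b2 _] := uq n; have [b3 _ _] := uq n.+1.
rewrite ler_pdivlMr ?ler_pdivrMr; lra.
Qed.

(** Division by [u n.+1] turns the error 20 into at most [h], and [u n.+3 / u n.+1] is the inverse
    of a product of two consecutive ratios. *)
Lemma ratio_recurrence u n (h : R) : quasi_recurrent u -> 0 < h <= 1 / 100 ->
  (forall k, (k <= 4)%N -> 20 / h <= u (k + n)%N) ->
  `|u n / u n.+1 - 2 - e n.+1 * (u n.+1 / u n.+2 * (u n.+2 / u n.+3))^-1| <= h.
Proof.
move=> uq /andP[h0 h1] ub.
have T0 : 2000 <= 20 / h by rewrite ler_pdivlMr //; lra.
have u1 := ub 1%N isT; have u2 := ub 2%N isT; have u3 := ub 3%N isT.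
have p1 : 0 < u n.+1 by lra.
have p2 : 0 < u n.+2 by lra.
have p3 : 0 < u n.+3 by lra.
have [_ _ b] := uq n.
have -> : u n / u n.+1 - 2 - e n.+1 * (u n.+1 / u n.+2 * (u n.+2 / u n.+3))^-1 =
   (u n - 2 * u n.+1 - e n.+1 * u n.+3) / u n.+1 by field; lra.
rewrite normrM normfV (gtr0_norm p1) ler_pdivrMr //.
apply: le_trans b _; rewrite mulrC -ler_pdivrMr //.
Qed.

(** Replacing one factor at a time leaves two terms, each with the inverse of a product of three
    numbers that are at least 13/10, and [(10 / 13) ^ 3 < 46 / 100]. *)
Lemma inv_mul_contraction (a b a' b' d : R) : 13 / 10 <= a -> 13 / 10 <= b ->
  13 / 10 <= a' -> 13 / 10 <= b' -> `|a - a'| <= d -> `|b - b'| <= d ->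
  `|(a * b)^-1 - (a' * b')^-1| <= 92 / 100 * d.
Proof.
move=> a1 b1 a2 b2 da db.
have d0 : 0 <= d by apply: le_trans da.
have -> : (a * b)^-1 - (a' * b')^-1 =
  (a' - a) * (a * (a' * b))^-1 + (b' - b) * (b * (a' * b'))^-1 by field; lra.
have inv3 (x y z : R) : 13 / 10 <= x -> 13 / 10 <= y -> 13 / 10 <= z ->
    0 <= (x * (y * z))^-1 <= 46 / 100.
  move=> x1 y1 z1.
  have yz : 169 / 100 <= y * z by nra.
  have xyz : 2197 / 1000 <= x * (y * z) by nra.
  rewrite invr_ge0; apply/andP; split; first by lra.
  by rewrite -[X in _ <= X]invrK lef_pV2 ?posrE; lra.
have /andP[i0 i1] := inv3 _ _ _ a1 a2 b1.
have /andP[j0 j1] := inv3 _ _ _ b1 a2 b2.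
apply: le_trans (ler_normD _ _) _;
  rewrite !normrM [`|a' - a|]distrC [`|b' - b|]distrC.
rewrite (ger0_norm i0) (ger0_norm j0).
have : `|a - a'| * (a * (a' * b))^-1 <= d * (46 / 100) by apply: ler_pM.
have : `|b - b'| * (b * (a' * b'))^-1 <= d * (46 / 100) by apply: ler_pM.
by lra.
Qed.

(** At first both ratios lie in an interval of length less than 2. Each use of the recurrence
    contracts by 92/100, adds [2 * h] and looks at most two indices further; [25 * h] is reproduced
    since [92 / 100 * 25 + 2 = 25]. *)
Lemma ratio_contraction u v n j (h : R) : quasi_recurrent u ->
  quasi_recurrent v ->
  0 < h <= 1 / 100 ->
  (forall k, (k <= n + j.*2 + 4)%N -> 20 / h <= u k) ->
  (forall k, (k <= n + j.*2 + 4)%N -> 20 / h <= v k) ->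
  `|u n / u n.+1 - v n / v n.+1| <= 2 * (92 / 100) ^+ j + 25 * h.
Proof.
move=> uq vq hh; elim: j n => [|j IH] n ub vb.
  have := ratio_bounds (n := n) uq hh; have := ratio_bounds (n := n) vq hh.
  move=> /(_ (vb _ _) (vb _ _)) v1 /(_ (ub _ _) (ub _ _)) u1.
  have {}v1 := v1 ltac:(lia) ltac:(lia); have {}u1 := u1 ltac:(lia) ltac:(lia).
  by rewrite expr0 ler_norml; lra.
have U k : (k <= 4)%N -> 20 / h <= u (k + n)%N by move=> ?; apply: ub; lia.
have V k : (k <= 4)%N -> 20 / h <= v (k + n)%N by move=> ?; apply: vb; lia.
have IH1 := IH n.+1; have IH2 := IH n.+2.
have {}IH1 := IH1 (fun k kn => ub k ltac:(lia)) (fun k kn => vb k ltac:(lia)).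
have {}IH2 := IH2 (fun k kn => ub k ltac:(lia)) (fun k kn => vb k ltac:(lia)).
have u1 := ratio_bounds uq hh (U 2 isT) (U 3 isT).
have u2 := ratio_bounds uq hh (U 3 isT) (U 4 isT).
have v1 := ratio_bounds vq hh (V 2 isT) (V 3 isT).
have v2 := ratio_bounds vq hh (V 3 isT) (V 4 isT).
have ur := ratio_recurrence uq hh (n := n) U.
have vr := ratio_recurrence vq hh (n := n) V.
case/andP: u1 => u1 _; case/andP: u2 => u2 _; case/andP: v1 => v1 _;
  case/andP: v2 => v2 _.
have := inv_mul_contraction u1 u2 v1 v2 IH1 IH2.
move: ur vr; rewrite exprS.
move: (u n / u n.+1) (v n / v n.+1) ((92 / 100) ^+ j) => r s w.
move: ((u n.+1 / u n.+2 * (u n.+2 / u n.+3))^-1) => ru.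
move: ((v n.+1 / v n.+2 * (v n.+2 / v n.+3))^-1) => rv.
clear -e_pm.
rewrite !ler_norml.
by case: (e_pm n.+1) => ->; rewrite ?mulN1r ?mul1r; lra.
Qed.

End Contraction.

(** * Limits that are uniform over all sequences of given types *)

Section Frequencies.
Variables (R : realType) (tau : nat -> bool).

Definition typed x := smooth x /\ forall j,
  kappa (iter j Δ x) = type_sign (tau j).

Hypothesis typed_nonempty : exists x, typed x.

(** A limit along this filter is a limit for the end point tending to infinity, uniform over all
    sequences of types [tau]. *)
Let F : set_system ((int -> symbol) * nat) :=
  filter_from [set: nat] (fun L => [set xp | typed xp.1 /\ (L <= xp.2)%N]).

#[local] Instance typed_filter : ProperFilter F.
Proof.
apply: filter_from_proper; last first.
  by move=> L _; have [x tx] := typed_nonempty; exists (x, L).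
apply: filter_from_filter; first by exists 0%N.
move=> i j _ _; exists (maxn i j) => // -[x p] [/= tx];
  rewrite geq_max => /andP[? ?].
by split.
Qed.

Let u n (xp : (int -> symbol) * nat) : R := (level_index xp.1 n xp.2%:Z)%:~R.
Let e n : R := (type_sign (tau n))%:~R.

Lemma type_sign_pm n : e n = 1 \/ e n = -1.
Proof. by rewrite /e; case: (tau n); [right|left]. Qed.

Lemma level_index_add x m n (p : int) :
  level_index (iter n Δ x) m (level_index x n p) = level_index x (m + n) p.
Proof. by elim: m => //= m ->; rewrite -iterD. Qed.

Lemma level_index_ge0 x n (p : int) : smooth x -> 0 <= p ->
  0 <= level_index x n p.
Proof.
by move=> sx p0; elim: n => //= n IH; have [] := block_index_bounds (sx n) IH.
Qed.

Lemma level_index_quasi_recurrent xp : typed xp.1 ->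
  quasi_recurrent e (u ^~ xp).
Proof.
case: xp => x p [/= sx kx] n.
have q0 := level_index_ge0 n sx (isT : 0 <= p%:Z).
have [i0 i1] := block_index_bounds (sx n) q0.
rewrite -[block_index _ _]/(level_index x n.+1 p%:Z) => i2.
have := index_sum_le (smooth_iter n sx) q0.
have := drift (level_index x n p%:Z) (smooth_iter n sx).
rewrite -iterS kx !level_index_add -[(1 + n)%N]/n.+1 -[(2 + n)%N]/n.+2 -[(3 +
  n)%N]/n.+3.
have uE k : u k (x, p) = (level_index x k p%:Z)%:~R by [].
rewrite !uE; move: i2.
move: (level_index x n _) (level_index x n.+1 _) (level_index x n.+2 _)
  (level_index x n.+3 _).
move=> a b c d i2 dr s; split.
- by rewrite -[20]/(20%:~R) -[3]/(3%:~R) -intrM -intrD ler_int; lia.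
- by rewrite -[20]/(20%:~R) -!intrD ler_int.
- rewrite -[20]/(20%:~R) -[2]/(2%:~R) -!intrM -!intrB -intr_norm ler_int.
  by rewrite mulr2n in dr; rewrite (_ : 2 * b = b + b) //; lia.
Qed.

(** Passing to the next level divides the count by at most 3, so p + 1 <= 3^n (N_n + 1). *)
Lemma level_index_large n (T : R) : \forall xp \near F, T <= u n xp.
Proof.
exists (Num.truncn (3 ^+ n * (`|T| + 1))).+1 => // -[x p] [/= [sx _]] pT.
have [q qP] : exists q : nat, (q%:Z = level_index x n p%:Z).
  have := level_index_ge0 n sx (isT : 0 <= p%:Z).
  by case: (level_index x n p%:Z) => q // _; exists q.
have : (p%:Z + 1 <= (3 ^ n)%N%:Z * (level_index x n p%:Z + 1)).
  elim: n {pT qP} => [|n IH]; first by rewrite expn0 mul1r.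
  have := block_index_bounds (sx n) (level_index_ge0 n sx (isT : 0 <= p%:Z)).
  move=> [_ _ b]; apply: le_trans IH _; rewrite expnS mulnC PoszM -mulrA.
  by apply: ler_wpM2l => //; rewrite /=; lia.
rewrite /u /= -qP -!PoszD -PoszM lez_nat !addn1 => pq.
have pq' : p%:R <= 3 ^+ n * (q%:R + 1) :> R.
  by rewrite -natrX -[1]/(1%:R) -natrD -natrM ler_nat addn1; exact: ltnW.
have : 3 ^+ n * (`|T| + 1) <= p%:R.
  have := truncnS_gt (3 ^+ n * (`|T| + 1)) => /ltW/le_trans; apply.
  by rewrite ler_nat.
move=> /le_trans/(_ pq'); rewrite ler_pM2l ?exprn_gt0 // lerD2r.
exact/le_trans/ler_norm.
Qed.

Lemma level_index_all_large n (T : R) :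
  \forall xp \near F, forall k, (k <= n)%N -> T <= u k xp.
Proof.
elim: n => [|n IH].
  by apply: filterS (level_index_large 0 T) => xp ? k; rewrite leqn0 => /eqP ->.
apply: filterS2 IH (level_index_large n.+1 T) => xp H1 H2 k.
by rewrite leq_eqVlt ltnS => /orP[/eqP ->//|/H1].
Qed.

Lemma near_typed : \forall xp \near F, typed xp.1.
Proof. by exists 0%N => // -[x p] []. Qed.

Lemma geometric_small (r eps : R) : 0 <= r < 1 -> 0 < eps ->
  exists j, r ^+ j <= eps.
Proof.
move=> /andP[r0 r1] eps0.
have : (fun j => r ^+ j) @ \oo --> (0 : R) by apply: cvg_expr;
  rewrite ger0_norm.
move=> /cvgrPdist_le/(_ _ eps0)[j _ /(_ j (leqnn j))] /=.
by rewrite sub0r normrN ger0_norm ?exprn_ge0 //; exists j.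
Qed.

(** [ratio_contraction] compares any two long intervals, even of different sequences, so the ratios
    are Cauchy along [F]. *)
Lemma ratio_cvg n : exists l : R, u n xp / u n.+1 xp @[xp --> F] --> l.
Proof.
apply/cvg_ex; apply/cauchy_cvgP; apply: cauchy_exP => eps eps0.
pose h := Num.min (1 / 100) (eps / 100).
have hh : 0 < h <= 1 / 100.
  by rewrite /h lt_min ge_min lexx andbT; lra.
have h2 : h <= eps / 100 by rewrite /h ge_min lexx orbT.
(* With [h <= eps / 100] the total error is at most [2 * (eps / 8) + 25 * (eps / 100) = eps / 2]. *)
have [//|//|j jP] := @geometric_small (92 / 100) (eps / 8).
- by lra.
- by lra.
pose A := [set xp | typed xp.1 /\ forall k, (k <= n + j.*2 + 4)%N ->
  20 / h <= u k xp].
have FA : F A by apply: filterI near_typed (level_index_all_large _ _).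
have [xp0 [t0 b0]] := filter_ex FA.
exists (u n xp0 / u n.+1 xp0); apply: (filterS _ FA) => xp [t1 b1] /=.
rewrite /ball /=.
have := ratio_contraction type_sign_pm (level_index_quasi_recurrent t0)
  (level_index_quasi_recurrent t1) hh b0 b1.
by move=> /le_lt_trans; apply; lra.
Qed.

Lemma near_ratio_lb n : \forall xp \near F,
  [/\ 0 < u n xp, 0 < u n.+1 xp & 13 / 10 <= u n xp / u n.+1 xp].
Proof.
apply: filterS2 near_typed (level_index_all_large n.+2 2000) => xp t b.
have hh : 0 < (1 / 100 : R) <= 1 / 100 by lra.
have b1 := b n.+1 (leqnSn _); have b2 := b n.+2 (leqnn _).
have b0 := b n (leq_trans (leqnSn _) (leqnSn _)).
have T : 20 / (1 / 100) <= (2000 : R) by lra.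
have := ratio_bounds (level_index_quasi_recurrent t) hh (le_trans T b1)
  (le_trans T b2).
by move=> /andP[? _]; split=> //; lra.
Qed.

(** The density at the next level is the present one divided by a ratio, whose limit is at least
    13/10 and thus nonzero. *)
Lemma density_cvg n : exists l : R, u n xp / u 0 xp @[xp --> F] --> l.
Proof.
elim: n => [|n [l lP]].
  exists 1; apply: cvg_near_cst.
  by apply: filterS (near_ratio_lb 0) => xp [u0 _ _]; rewrite divff // gt_eqF.
have [r rP] := ratio_cvg n.
have r0 : r != 0.
  suff : 13 / 10 <= r by move=> ?; apply/eqP; lra.
  by apply: (cvgr_to_ge rP); apply: filterS (near_ratio_lb n) => xp [].
exists (l * r^-1); apply: cvg_trans (cvgM lP (cvgV r0 rP)).
apply: near_eq_cvg; apply: filterS2 (near_ratio_lb n) (near_ratio_lb 0).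
move=> xp [u1 u2 _] [u0 _ _] /=.
by field; rewrite !gt_eqF.
Qed.

Lemma density_small n : \forall xp \near F, u n xp / u 0 xp <= (10 / 13) ^+ n.
Proof.
elim: n => [|n IH].
  by apply: filterS (near_ratio_lb 0) => xp [u0 _ _];
    rewrite divff ?expr0 // gt_eqF.
apply: filterS3 IH (near_ratio_lb n) (near_ratio_lb 0) =>
  xp IH [u1 u2 b] [u0 _ _].
rewrite exprS; have -> : u n.+1 xp / u 0 xp =
  (u n xp / u n.+1 xp)^-1 * (u n xp / u 0 xp).
  by field; rewrite !gt_eqF.
apply: ler_pM => //.
- by rewrite invr_ge0; lra.
- by rewrite divr_ge0 // ltW.
- by rewrite -[X in _ <= X]invrK lef_pV2 ?posrE; lra.
Qed.

Lemma intr_linear_bound (S a c d x y z k C : int) :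
  `|4 * S - (a * x + c * y + d * z)| <= 16 * k * x + C ->
  `|4 * S%:~R - (a%:~R * x%:~R + c%:~R * y%:~R + d%:~R * z%:~R)| <=
    16 * k%:~R * x%:~R + C%:~R :> R.
Proof.
by rewrite -[X in X * S%:~R]/(4%:~R) -[X in X * k%:~R]/(16%:~R) -!intrM -!intrD
  -intrB -intr_norm ler_int.
Qed.

(** For each [eps] a level is taken so high that block boundaries cost little; the linear
    combination of densities that remains converges. Its limit [L] depends on that level, hence the
    Cauchy criterion. *)
Lemma birkhoff_cvg (f : (int -> symbol) -> int) (m : nat) :
  (forall x, `|f x| <= 1) -> (forall x y, @agree symbol m x y -> f x = f y) ->
  exists l : R, (birkhoff_sum f xp.1 xp.2%:Z)%:~R / u 0 xp @[xp --> F] --> l.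
Proof.
move=> f1 fm.
apply/cvg_ex; apply/cauchy_cvgP; apply: cauchy_exP => eps eps0.
(* Chosen so that the boundary term is at most [16 * m * eps / (32 * (m + 1)) <= eps / 2]. *)
have d0 : 0 < eps / (32 * (m%:R + 1)).
  by apply: divr_gt0 => //; apply: mulr_gt0; rewrite ?ltr0n // ltr_wpDl ?ler0n.
have [|n nP] := @geometric_small (10 / 13) _ _ d0; first by lra.
have [a [c [d [C fP]]]] := birkhoff_levels f1 fm (fun j => type_sign (tau j)) n.
have [l1 l1P] := density_cvg n.+1; have [l2 l2P] := density_cvg n.+2.
have [l3 l3P] := density_cvg n.+3.
pose lin xp := a%:~R * (u n.+1 xp / u 0 xp) + c%:~R * (u n.+3 xp / u 0 xp)
   + d%:~R * (u n.+2 xp / u 0 xp).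
pose L := a%:~R * l1 + c%:~R * l3 + d%:~R * l2.
have linP : lin xp @[xp --> F] --> L.
  by apply: cvgD; [apply: cvgD|]; apply: cvgMl_tmp.
have /cvgrPdist_le/(_ (eps / 4)) near_lin := linP.
have {}near_lin := near_lin ltac:(lra).
exists (L / 4).
suff : \forall xp \near F,
    `|L / 4 - (birkhoff_sum f xp.1 xp.2%:Z)%:~R / u 0 xp| < eps by [].
near=> xp.
have [sx kx] : typed xp.1 by near: xp; exact: near_typed.
have u0 : 4 * `|C|%:~R / eps + 1 <= u 0 xp by near: xp;
  exact: level_index_large.
have uS : u n.+1 xp / u 0 xp <= (10 / 13) ^+ n.+1 by near: xp;
  exact: density_small.
have lin1 : `|L - lin xp| <= eps / 4 by near: xp.
have p0 : 0 < u 0 xp by apply: lt_le_trans u0;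
  rewrite ltr_wpDl // divr_ge0 ?mulr_ge0 ?ler0z // ltW.
have Cp : C%:~R / u 0 xp <= eps / 4.
  rewrite ler_pdivrMr //; apply: (@le_trans _ _ `|C|%:~R);
    first by rewrite ler_int ler_norm.
  have : 4 * `|C|%:~R / eps <= u 0 xp by lra.
  by rewrite ler_pdivrMr //; lra.
have /intr_linear_bound := fP xp.1 xp.2%:Z sx kx isT.
set S := birkhoff_sum _ _ _.
rewrite -/(u n.+1 xp) -/(u n.+2 xp) -/(u n.+3 xp) => SP.
have {}SP : `|4 * (S%:~R / u 0 xp) - lin xp| <=
  16 * m%:R * (u n.+1 xp / u 0 xp) + C%:~R / u 0 xp.
  have -> : 4 * (S%:~R / u 0 xp) - lin xp =
    (4 * S%:~R - (a%:~R * u n.+1 xp + c%:~R * u n.+3 xp + d%:~R * u n.+2 xp)) /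
      u 0 xp.
    by rewrite /lin; field; rewrite gt_eqF.
  rewrite normrM normfV (gtr0_norm p0) ler_pdivrMr //.
  have -> : (16 * m%:R * (u n.+1 xp / u 0 xp) + C%:~R / u 0 xp) * u 0 xp =
      16 * m%:R * u n.+1 xp + C%:~R by field; rewrite gt_eqF.
  exact: SP.
have mS : 16 * m%:R * (u n.+1 xp / u 0 xp) <= eps / 2.
  have : u n.+1 xp / u 0 xp <= eps / (32 * (m%:R + 1)).
    apply: le_trans uS _; apply: le_trans nP;
      rewrite exprS ler_piMl ?exprn_ge0 //; lra.
  rewrite ler_pdivlMr; last by apply: mulr_gt0;
    rewrite ?ltr0n // ltr_wpDl ?ler0n.
  have : 0 <= u n.+1 xp / u 0 xp.
    by rewrite divr_ge0 ?(ltW p0) // ler0z; exact: level_index_ge0.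
  by have := ler0n R m; nra.
have : `|4 * (S%:~R / u 0 xp) - L| < 4 * eps.
  apply: (le_lt_trans (ler_distD (lin xp) _ _));
    rewrite [`|lin xp - L|]distrC; lra.
rewrite !ltr_norml => /andP[? ?]; apply/andP; split; lra.
Unshelve. all: by end_near. Qed.

Lemma birkhoff_uniform (f : (int -> symbol) -> int) (m : nat) :
  (forall x, `|f x| <= 1) -> (forall x y, @agree symbol m x y -> f x = f y) ->
  exists l : R, forall eps, 0 < eps -> exists N, forall x (p : nat),
    typed x -> (N <= p)%N ->
    `|(birkhoff_sum f x p%:Z)%:~R - l * p%:R| <= eps * p%:R.
Proof.
move=> f1 fm; have [l lP] := birkhoff_cvg f1 fm.
exists l => eps eps0; move/cvgrPdist_le : lP => /(_ eps eps0)[N _ NP].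
exists N.+1 => x p tx Np; have p0 : 0 < p%:R :> R by rewrite ltr0n; lia.
have /= := NP (x, p) (conj tx (ltnW Np)).
rewrite distrC -(ler_pM2r p0) -[X in _ * X <= _](gtr0_norm p0) -normrM.
by rewrite mulrBl divfK ?gt_eqF.
Qed.

End Frequencies.

(** * The sets of prescribed types are subshifts *)

Local Notation agree13 := (@agree symbol).


(** Blocks [-N] to [N] start within [3 * N + 2] of 0; they are compared outwards from block 0 in
    both directions. *)
Lemma block_start_agree N x y : D x -> D y -> agree13 (3 * N + 10)%N x y ->
  forall k : int, (`|k| <= N)%N -> block_start x k = block_start y k.
Proof.
move=> Dx Dy xy; have bx := block_startP Dx.1; have bY := block_startP Dy.1.
have xyE (i : int) : (`|i| <= 3 * N%:Z + 10) -> x i = y i by move=> iN;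
  apply: xy; lia.
suff H n : (n <= N)%N -> block_start x n%:Z = block_start y n%:Z /\
    block_start x (- n%:Z) = block_start y (- n%:Z).
  move=> k kN; have [kE|kE] : k = (absz k)%:Z \/ k = - (absz k)%:Z by lia.
    by rewrite kE; exact: (H _ kN).1.
  by rewrite kE; exact: (H _ kN).2.
elim: n => [|n IH] nN.
  have x0 := block_start0_bounds Dx; have y0 := block_start0_bounds Dy.
  have [x1 _] := bx; have [y1 _] := bY.
  have E : - Posz 0 = (0 : int) by [].
  rewrite E -[Posz 0]/(0 : int).
  suff -> : block_start x 0 = block_start y 0 by [].
  have := block_startS 0 Dx; have := len_pm (Δ x 0); rewrite add0r => ln S0.
  by apply: (block_starts_eq bx bY); rewrite ?add0r //; [lia|lia|move=> i ?;
    apply: xyE; lia].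
have [IH1 IH2] := IH (ltnW nN).
have [u1 u2] := block_start_bounds n Dx.
have [v1 v2] := block_start_bounds n.+1 Dx.
split.
  have E : n.+1%:Z = n%:Z + 1 by lia.
  rewrite E in v1 *; apply: (block_starts_next_eq bx bY IH1) => i ?;
    apply: xyE; lia.
have E : - n.+1%:Z + 1 = - n%:Z by lia.
apply: (@block_starts_eq _ x y _ _ (- n.+1%:Z) (- n.+1%:Z) bx bY); rewrite E.
- by rewrite IH2; have [_ /(_ (- n.+1%:Z))[]] := bY; rewrite E.
- by rewrite -IH2; have [_ /(_ (- n.+1%:Z))[]] := bx; rewrite E.
- by move=> i ?; apply: xyE; lia.
Qed.

Lemma derivative_agree N x y : D x -> D y -> agree13 (3 * N + 13)%N x y ->
  agree13 N (Δ x) (Δ y).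
Proof.
move=> Dx Dy xy k kN; rewrite /derivative13 /block_length.
have bxy := @block_start_agree N.+1 x y Dx Dy (agree_le _ xy).
by rewrite !bxy //; lia.
Qed.

Definition limit_closed (P : (int -> symbol) -> Prop) :=
  forall x, (forall M, exists2 y, P y & agree13 M x y) -> P x.

(** Finiteness of the blocks alone does not pass to limits. The bound 3 on their lengths does the
    work: block [k] is seen in a window whose size depends on [k] only. *)
Lemma differentiable_limit_closed : limit_closed D.
Proof.
move=> x xlim; pose M n := (3 * n + 20)%N.
have [n|y yP] := @choice nat (int ->
  symbol) (fun n y => D y /\ agree13 (M n) x y).
  by have [y Dy xy] := xlim (M n); exists y.
(* Block [k] is read off approximation [|k|]; by [block_start_agree] all later ones give the same
   start. *)
pose b k := block_start (y (absz k)) k.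
have bE (n : nat) (k : int) : (`|k| <= n)%N -> b k = block_start (y n) k.
  move=> kn; apply: (@block_start_agree (absz k)) => //; try exact: (yP _).1.
  move=> i ik; rewrite -(yP (absz k)).2 ?(yP n).2 // /M; lia.
have bx : is_block_starts x b.
  split.
    rewrite (bE 1%N 0) ?(bE 1%N 1) //.
    by have [fy _] := (yP 1%N).1; case: (block_startP fy).
  move=> k; pose n := (absz k).+1.
  have [Dy xy] := yP n; have [_ /(_ k)[lt_b cst ne]] := block_startP Dy.1.
  have bk : b k = block_start (y n) k by apply: bE; lia.
  have bk1 : b (k + 1) = block_start (y n) (k + 1) by apply: bE; lia.
  have bb : - 3 * n%:Z - 5 <= block_start (y n) k /\ block_start (y n) (k + 1)
    <= 3 * n%:Z + 5.
    have [c1 c2] := block_start_bounds (absz k) Dy.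
    have S1 := block_startS k Dy; have := len_pm (Δ (y n) k).
    have [kE|kE] : k = (absz k)%:Z \/ k = - (absz k)%:Z by lia.
      by rewrite -kE in c1; lia.
    by rewrite -kE in c2; lia.
  have xyE (i : int) : block_start (y n) k <= i <=
    block_start (y n) (k + 1) -> x i = y n i.
    by move=> ?; apply: xy; rewrite /M; lia.
  rewrite bk bk1; split=> //.
    by move=> i ?; rewrite !xyE; [apply: cst|..]; lia.
  by rewrite !xyE; lia || exact: ne.
split; first by exists b.
move=> k; rewrite /block_length (block_startE bx).
have [_ /(_ k)] := (yP (absz k).+1).1; rewrite /block_length.
by rewrite -!bE //; lia.
Qed.

(** The letters of [y] prescribe the block lengths and the symbols alternate, which leaves one free
    choice: the symbol of block [k0]. *)
Lemma integrate y (k0 : int) s : exists x, [/\ D x,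
  Δ x = y & x (block_start x k0) = s].
Proof.
pose b k := isum (fun i => len (y i)) k.
have bS (k : int) : b (k + 1) = b k + len (y k) by exact: isumS.
have b_lt (k : int) : b k < b (k + 1) by rewrite bS; have := len_pm (y k); lia.
have b0 : b 0 <= 0 < b 1.
  have E : b 0 = 0 by exact: isum0.
  by have := b_lt 0; rewrite add0r E; lia.
have /choice[idx idxP] : forall p, exists k, b k <= p < b (k + 1).
  by move=> p; exact: increasing_cover.
have idxE (k p : int) : b k <= p < b (k + 1) -> idx p = k.
  by move=> kP; exact: increasing_cover_unique b_lt _ _ _ (idxP p) kP.
have idxb (k : int) : idx (b k) = k by apply: idxE; have := b_lt k; lia.
pose x (p : int) := if odd (absz (idx p - k0)%R) then flip s else s.
have bx : is_block_starts x b.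
  split=> // k; split=> //.
    by move=> i ik; rewrite /x idxb (idxE k).
  rewrite /x !idxb.
  have -> : odd (absz (k + 1 - k0)%R) = ~~ odd (absz (k - k0)%R) by lia.
  by case: (odd _); case: (s).
have lenE (k : int) : block_length x k = absz (len (y k)).
  by rewrite /block_length (block_startE bx) bS addrAC subrr add0r.
exists x; split.
- by split=> [|k]; [exists b|rewrite lenE; case: (y k); auto].
- by apply/funext => k; rewrite /derivative13 lenE; case: (y k).
- by rewrite (block_startE bx) /x idxb subrr.
Qed.

(** Finitely many of the conditions defining [typed tau]: closed, satisfiable by repeated
    integration, and decreasing in [n], as the compactness argument requires. *)
Fixpoint typed_upto (tau : nat -> bool) n x : Prop :=
  if n is n'.+1 then
    [/\ D x, kappa x = type_sign (tau 0%N) & typed_upto (fun j =>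
      tau j.+1) n' (Δ x)]
  else D x.

Lemma typed_upto_differentiable tau n x : typed_upto tau n x -> D x.
Proof. by case: n => //= n []. Qed.

Lemma typed_uptoW tau n x : typed_upto tau n.+1 x -> typed_upto tau n x.
Proof.
elim: n tau x => [|n IH] tau x; first by case.
by move=> [Dx kx tx]; split=> //; exact: IH.
Qed.

Lemma typed_upto_limit_closed tau n : limit_closed (typed_upto tau n).
Proof.
elim: n tau => [|n IH] tau x xlim; first exact: differentiable_limit_closed.
have Dx : D x.
  by apply: differentiable_limit_closed => M; have [y [Dy _ _] xy] := xlim M;
    exists y.
have Tx : typed_upto (fun j => tau j.+1) n (Δ x).
  apply: IH => M; have [y [Dy _ Ty] xy] := xlim (3 * M + 13)%N.
  by exists (Δ y) => //; exact: derivative_agree.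
split=> //.
(* Radius 100 is ample: it fixes [Δ x] on radius 10 and the starts of the blocks -2 to 0 of [x],
   which determine [kappa x]. *)
have [y [Dy <- Ty] xy] := xlim 100%N.
have Dx1 := typed_upto_differentiable Tx;
  have Dy1 := typed_upto_differentiable Ty.
have xy1 : agree13 10 (Δ x) (Δ y) by apply: derivative_agree => //;
  exact: agree_le xy.
rewrite /kappa /block_sign (xy1 0) //.
have -> : block_start (Δ x) 0 = block_start (Δ y) 0.
  exact: (@block_start_agree 0).
have c := block_start0_bounds Dy1; set k := block_start _ 0 in c *.
have -> : block_start x k = block_start y k.
  by apply: (@block_start_agree 2) => //; [exact: agree_le xy|lia].
rewrite xy //.
have kE : k = - (absz k)%:Z by lia.
by have [_] := block_start_bounds (absz k) Dy; rewrite -kE; lia.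
Qed.

Lemma typed_upto_nonempty tau n : exists x, typed_upto tau n x.
Proof.
elim: n tau => [|n IH] tau;
  first by have [x [Dx _ _]] := integrate (fun=> One) 0 One; exists x.
have [y Ty] := IH (fun j => tau j.+1).
have Dy := typed_upto_differentiable Ty.
pose k0 := block_start y 0.
(* [kappa x] will be the product of the signs of [s] and [y 0]: equal symbols give type 0, opposite
   ones type 1. *)
pose s := if tau 0%N then flip (y 0) else y 0.
have [x [Dx xy xs]] := integrate y k0 s.
exists x; split=> //; last by rewrite xy.
rewrite /kappa /block_sign xy xs /s.
by case: (tau 0%N); case: (y 0).
Qed.

Lemma typedP tau x : typed tau x <-> forall n, typed_upto tau n x.
Proof.
split=> [tx n|tx].
  elim: n tau x tx => [|n IH] tau x [sx kx]; first exact: (sx 0%N).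
  split; [exact: (sx 0%N)|exact: (kx 0%N)|].
  apply: IH; split; first exact: smooth_derivative.
  by move=> j; rewrite -iterSr; exact: (kx j.+1).
suff H n : D (iter n Δ x) /\ kappa (iter n Δ x) = type_sign (tau n).
  by split=> n; case: (H n).
elim: n tau x tx => [|n IH] tau x tx.
  by have [? ? _] := tx 1%N.
rewrite iterSr; apply: (IH (fun j => tau j.+1)) => m.
by have [] := tx m.+1.
Qed.

Lemma closed_limit (B : set (full_shift symbol)) : limit_closed B -> closed B.
Proof.
move=> lB x xB; apply: lB => M.
have [y [By xy]] := xB _ (nbhs_agree M x).
by exists y.
Qed.

Lemma typed_closed tau : closed (typed tau : set (full_shift symbol)).
Proof.
have -> : typed tau = \bigcap_n (typed_upto tau n : set (full_shift symbol)).
  by apply/seteqP; split=> x; [move=> /typedP tx n _|move=> tx;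
    apply/typedP => n; exact: tx].
by apply: closed_bigI => n _; apply: closed_limit;
  exact: typed_upto_limit_closed.
Qed.

Lemma typed_nonempty tau : exists x, typed tau x.
Proof.
have [||n x|x tx] := @nested_closed_nonempty symbol (typed_upto tau).
- by move=> n; apply: closed_limit; exact: typed_upto_limit_closed.
- by move=> n; have [x ?] := typed_upto_nonempty tau n; exists x.
- exact: typed_uptoW.
- by exists x; apply/typedP => n; exact: tx.
Qed.

Lemma typed_translate tau x (p : int) : typed tau x ->
  typed tau (translate p x).
Proof.
move=> [sx kx]; split=> [|j]; first exact: smooth_translate.
by rewrite iter_derivative_translate // kappa_translate //; exact: (sx j.+1).
Qed.

Lemma smooth_of_typesE tau : smooth_of_types tau = typed tau.
Proof.
apply/seteqP; split=> x [sx tx]; split=> // n.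
  by apply/has_typeE => //; exact: smooth_iter.
by apply/has_typeE; [exact: smooth_iter|exact: tx].
Qed.

Lemma smooth_of_types_subshift tau : is_subshift (smooth_of_types tau).
Proof.
rewrite smooth_of_typesE; split.
- by have [x tx] := typed_nonempty tau; exists x.
- exact: typed_closed.
- apply/seteqP; split=> [_ [x tx <-]|x tx]; first exact: (typed_translate 1).
  exists (translate (-1) x); first exact: typed_translate.
  by apply/funext => n; rewrite /Defs.shift /translate addrK.
Qed.

(** The visits to a clopen set are the Birkhoff sums of the indicator of a local set, whose uniform
    frequency comes from [birkhoff_uniform]. *)
Lemma smooth_of_types_uniquely_ergodic (R : realType) tau
  (hX : is_subshift (smooth_of_types tau)) :
  uniquely_ergodic R (@shift_on symbol (Subshift hX)).
Proof.
apply: uniform_frequencies_uniquely_ergodic => A [B [m Bm] ->].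
pose f (x : int -> symbol) : int := `[< B x >]%:Z.
have f1 x : `|f x| <= 1 by rewrite /f; case: asboolP.
have fm x y : agree13 m x y -> f x = f y.
  move=> xy; rewrite /f; congr (Posz (nat_of_bool _)).
  by apply/asbool_equiv_eq; split; [exact: Bm|apply: Bm; exact: agree_sym].
have iterE i (x : subshift_space (Subshift hX)) :
    set_val (iter i (@shift_on symbol (Subshift hX)) x) =
      translate i%:Z (set_val x).
  elim: i => [|i IH]; first by apply/funext => n; rewrite /translate addr0.
  rewrite iterS; apply/funext => n.
  transitivity (Defs.shift (set_val (iter i (@shift_on symbol (Subshift hX))
    x)) n) => //.
  rewrite IH /Defs.shift /translate; congr (set_val x _); lia.
have visitsE n (x : subshift_space (Subshift hX)) :
    visits R (set_val @^-1` B) n x = (birkhoff_sum f (set_val x) n%:Z)%:~R.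
  rewrite /visits /birkhoff_sum /isum rmorph_sum /=; apply: eq_bigr => i _.
  by rewrite /f -iterE indicE.
have [l lP] := birkhoff_uniform R (typed_nonempty tau) f1 fm.
exists l => e /lP[N NP]; exists N => n x Nn; rewrite visitsE; apply: NP => //.
by rewrite -smooth_of_typesE; exact: set_valP.
Qed.

Theorem mainTheorem1 (R : realType) :
  [/\ forall tau : nat -> bool,
        exists hX : is_subshift (smooth_of_types tau),
          uniquely_ergodic R (@shift_on symbol (Subshift hX)),
      smooth_sequences = \bigcup_(tau : nat -> bool) smooth_of_types tau &
      trivIset [set: nat -> bool] smooth_of_types].
Proof.
split.
- move=> tau; exists (smooth_of_types_subshift tau).
  exact: smooth_of_types_uniquely_ergodic.
- apply/seteqP; split=> [x sx|x [tau _ []//]].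
  exists (fun n => kappa (iter n Δ x) == -1) => //.
  rewrite smooth_of_typesE; split=> // j.
  by case: eqP => // ?; case: (kappa_pm (iter j Δ x)).
- move=> tau tau' _ _ [x []]; rewrite !smooth_of_typesE => -[_ k] [_ k'].
  by apply/funext => n; apply: type_sign_inj; rewrite -k -k'.
Qed.
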